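(* Let $k\in\mathbb N$. Then, with $r=r(n)$, $$\lim_{n\to\infty}\Big((nr^d)^{-1}\log(I_{n,k}/n)\Big)=-\theta f_0.$$
   Context: Setting. Let $d\in\mathbb N$; $\mathrm{Vol}$ is Lebesgue measure, $\theta$ is the volume of the unit-radius ball in $\mathbb R^d$. Let $A\subset\mathbb R^d$ be compact with $\mathrm{Vol}(A)>0$. If $d\ge2$, $A$ has a $C^{1,1}$ boundary: for each $x\in\partial A$ there are a neighbourhood $U$ of $x$ and a real-valued function $\phi$, defined on an open set in $\mathbb R^{d-1}$ and differentiable with Lipschitz continuous partial derivatives, such that $\partial A\cap U$, after a rotation, is the graph of $\phi$. If $d=1$, $A$ is an interval. Let $X_1,X_2,\ldots$ be i.i.d. random vectors in $\mathbb R^d$ with distribution $\nu$ having density $f$ and support $A$, with $f$ continuous on $A$. Put $f_0=\inf_Af$, $f_1=\inf_{\partial A}f$, and assume $f_0>0$. For real $n>0$ let $Z_n$ be Poisson with mean $n$, independent of $(X_i)$, and $\mathcal P_n=\{X_1,\ldots,X_{Z_n}\}$ (a Poisson process with intensity $nf$). For finite $\mathcal X\subset\mathbb R^d$ and $r>0$, $G(\mathcal X,r)$ is the graph on $\mathcal X$ with an edge between each pair of distinct points at Euclidean distance at most $r$, and $K_{k,r}(\mathcal X)$ is the number of connected components of $G(\mathcal X,r)$ with exactly $k$ vertices. Put $S'_{n,k}=K_{k,r(n)}(\mathcal P_n)$, $I_{n,k}=\mathbb E[S'_{n,k}]$. The sequence $r=r(n)>0$ satisfies $\lim_{n\to\infty}nr(n)^d=\infty$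 and $\limsup_{n\to\infty}\frac{\theta nr(n)^d}{\log n}<\frac1{\max(f_0,\,d(f_0-f_1/2))}$. *)

(* Defs.v *)
From HB Require Import structures.
From mathcomp Require Import all_boot all_order all_algebra finmap.
From mathcomp Require Import all_classical all_reals all_analysis.

Set Implicit Arguments.
Unset Strict Implicit.
Unset Printing Implicit Defensive.

Import Order.TTheory GRing.Theory Num.Theory.
Import numFieldNormedType.Exports.

Local Open Scope classical_set_scope.
Local Open Scope ring_scope.

(* The Borel sigma-algebra of R^d, generated by the coordinate maps, as the
   library does for tuples. *)
Section measurable_rV.
Context {R : realType} {d : nat}.

Let coord (i : 'I_d) (x : 'rV[R]_d) : R := x ord0 i.

Definition rV_measurable : set_system 'rV[R]_d :=
  <<s \bigcup_i preimage_set_system setT (coord i) measurable >>.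

Let rV_measurable0 : rV_measurable set0.
Proof. exact: sigma_algebra0. Qed.

Let rV_measurableC A : rV_measurable A -> rV_measurable (~` A).
Proof. exact: sigma_algebraC. Qed.

Let rV_measurable_bigcup (F : (set 'rV[R]_d)^nat) :
  (forall i, rV_measurable (F i)) -> rV_measurable (\bigcup_i F i).
Proof. exact: sigma_algebra_bigcup. Qed.

HB.instance Definition _ := @isMeasurable.Build
  (measure_tuple_display default_measure_display) 'rV[R]_d rV_measurable
  rV_measurable0 rV_measurableC rV_measurable_bigcup.

End measurable_rV.

Section lebesgue_rV.
Context {R : realType}.

Lemma measurable_rV_coord d (i : 'I_d) :
  measurable_fun setT (fun x : 'rV[R]_d => x ord0 i : R).
Proof.
move=> _ B mB; apply: sub_sigma_algebra.
by exists i => //; exists B.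
Qed.

Lemma measurable_fun_rV d disp (T : measurableType disp) (f : T -> 'rV[R]_d) :
  (forall i, measurable_fun setT (fun t => f t ord0 i : R)) ->
  measurable_fun setT f.
Proof.
move=> mf; apply: (measurability (\bigcup_(i : 'I_d)
  preimage_set_system setT (fun x : 'rV[R]_d => x ord0 i : R) measurable)) => //.
move=> _ [_ [i _ [B mB <-]] <-].
by have := mf i measurableT B mB; rewrite !setTI.
Qed.

Definition consrV d (p : R * 'rV[R]_d) : 'rV[R]_d.+1 :=
  \row_i oapp (p.2 ord0) p.1 (unlift ord0 i).

Definition unconsrV d (x : 'rV[R]_d.+1) : R * 'rV[R]_d :=
  (x ord0 ord0, \row_j x ord0 (lift ord0 j)).

Lemma consrVK d : cancel (@consrV d) (@unconsrV d).
Proof.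
move=> [t x]; rewrite /unconsrV mxE unlift_none /=; congr pair.
by apply/rowP => j; rewrite !mxE liftK.
Qed.

(* [lebesgue_measure] lives on [measurableTypeR R], whose display differs from
   that of [R]. *)
Lemma measurable_consrV d : measurable_fun setT
  (@consrV d : measurableTypeR R * 'rV[R]_d -> 'rV[R]_d.+1).
Proof.
apply: measurable_fun_rV => i; rewrite /consrV.
case: (unliftP ord0 i) => [j|] ->.
  rewrite (_ : (fun _ => _) = (fun x : 'rV[R]_d => x ord0 j : R) \o snd).
    by apply: measurableT_comp => //; exact: measurable_rV_coord.
  by apply/funext => p /=; rewrite mxE liftK.
rewrite (_ : (fun _ => _) = fst) //.
by apply/funext => p /=; rewrite mxE unlift_none.
Qed.

Lemma measurable_unconsrV d : measurable_fun setT
  (@unconsrV d : 'rV[R]_d.+1 -> measurableTypeR R * 'rV[R]_d).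
Proof.
apply/measurable_fun_pairP; split; first exact: measurable_rV_coord.
apply: measurable_fun_rV => j.
rewrite (_ : (fun _ => _) = (fun x : 'rV[R]_d.+1 => x ord0 (lift ord0 j) : R)).
  exact: measurable_rV_coord.
by apply/funext => x; rewrite /= mxE.
Qed.

Section step.
Context d (mu : {sigma_finite_measure set 'rV[R]_d -> \bar R}).

Definition lebesgue_rV_step : set 'rV[R]_d.+1 -> \bar R :=
  pushforward (@lebesgue_measure R \x mu)%E (@consrV d).

Let lebesgue_rV_step0 : lebesgue_rV_step set0 = 0%E.
Proof. by rewrite /lebesgue_rV_step /pushforward preimage_set0 measure0. Qed.

Let lebesgue_rV_step_ge0 B : (0 <= lebesgue_rV_step B)%E.
Proof. by rewrite /lebesgue_rV_step /pushforward; apply: measure_ge0. Qed.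

Let lebesgue_rV_step_sigma_additive : semi_sigma_additive lebesgue_rV_step.
Proof.
move=> F mF tF mUF; rewrite /lebesgue_rV_step /pushforward preimage_bigcup.
apply: measure_semi_sigma_additive.
- by move=> n; rewrite -[X in measurable X]setTI; exact: measurable_consrV.
- apply/trivIsetP => /= i j _ _ ij; rewrite -preimage_setI.
  by move/trivIsetP : tF => /(_ _ _ _ _ ij) ->//; rewrite preimage_set0.
- by rewrite -preimage_bigcup -[X in measurable X]setTI; exact: measurable_consrV.
Qed.

HB.instance Definition _ := isMeasure.Build _ _ _ lebesgue_rV_step
  lebesgue_rV_step0 lebesgue_rV_step_ge0 lebesgue_rV_step_sigma_additive.

Lemma lebesgue_rV_step_sigma_finite : sigma_finite setT lebesgue_rV_step.
Proof.
have /sigma_finiteP[F [FT ndF Foo]] := sigma_finiteT (@lebesgue_measure R).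
have /sigma_finiteP[G [GT ndG Goo]] := sigma_finiteT mu.
exists (fun k => @unconsrV d @^-1` (F k `*` G k)).
  apply/seteqP; split => // x _.
  have [i _ Fi] : (\bigcup_i F i) (unconsrV x).1 by rewrite -FT.
  have [j _ Gj] : (\bigcup_j G j) (unconsrV x).2 by rewrite -GT.
  exists (maxn i j) => //; split.
    by move: Fi; apply/subsetPset/ndF/leq_maxl.
  by move: Gj; apply/subsetPset/ndG/leq_maxr.
move=> k; have [mF Fk] := Foo k; have [mG Gk] := Goo k; split.
  rewrite -[_ @^-1` _]setTI; apply: measurable_unconsrV => //.
  exact: measurableX.
rewrite /lebesgue_rV_step /pushforward -comp_preimage.
rewrite (_ : _ \o _ = id); last by apply/funext => p /=; exact: consrVK.
by rewrite preimage_id product_measure1E// lte_mul_pinfty// ge0_fin_numE.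
Qed.

HB.instance Definition _ := Measure_isSigmaFinite.Build _ _ _ lebesgue_rV_step
  lebesgue_rV_step_sigma_finite.

End step.

Fixpoint lebesgue_rV d : {sigma_finite_measure set 'rV[R]_d -> \bar R} :=
  if d is d'.+1 then lebesgue_rV_step (lebesgue_rV d')
  else \d_(0 : 'rV[R]_0).

(* The volume of a box, which determines the measure. *)
Lemma lebesgue_rV_box d (B : 'I_d -> set R) : (forall i, measurable (B i)) ->
  lebesgue_rV d [set x | forall i, B i (x ord0 i)] =
  (\prod_(i < d) lebesgue_measure (B i))%E.
Proof.
elim: d B => [|d IH] B mB.
  by rewrite big_ord0 /= diracE mem_set // => -[].
pose C := [set x : 'rV[R]_d | forall j, B (lift ord0 j) (x ord0 j)].
have mC : measurable C.
  rewrite (_ : C = \bigcap_(j in @setT 'I_d)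
    ((fun x : 'rV[R]_d => x ord0 j : R) @^-1` B (lift ord0 j))).
    apply: fin_bigcap_measurable => // j _.
    by rewrite -[_ @^-1` _]setTI; exact: measurable_rV_coord.
  by apply/seteqP; split => [x Bx j _|x Bx j]; [exact: Bx|exact: (Bx j)].
rewrite big_ord_recl -(IH (fun j => B (lift ord0 j)) (fun j => mB _)).
have /= <- := product_measure1E (@lebesgue_measure R) (lebesgue_rV d)
  (mB ord0) mC.
rewrite /= /lebesgue_rV_step /pushforward; congr (_ _).
apply/seteqP; split => [[t x] /= Bx|[t x] [/= Bt Bx] i /=].
  split => /= [|j]; first by have := Bx ord0; rewrite mxE unlift_none.
  by have := Bx (lift ord0 j); rewrite mxE liftK.
by rewrite mxE; case: (unliftP ord0 i) => [j|] -> /=.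
Qed.

End lebesgue_rV.

(* The library norm on ['rV[R]_d] is the sup norm; its topology and Lipschitz
   functions are the Euclidean ones, but its balls are not. *)
Definition enorm (R : rcfType) d (x : 'rV[R]_d) : R :=
  Num.sqrt (\sum_(i < d) x ord0 i ^+ 2).

Definition unit_ball_volume (R : realType) d : R :=
  fine (lebesgue_rV d [set x : 'rV[R]_d | enorm x <= 1]).

Definition boundary (T : topologicalType) (A : set T) : set T :=
  closure A `\` interior A.

Definition C11_on (R : realType) m (V : set 'rV[R]_m) (phi : 'rV[R]_m -> R) :=
  (forall u, V u -> differentiable phi u) /\
  (forall i : 'I_m, [lipschitz 'D_(delta_mx ord0 i) phi u | u in V]).

Definition graph_over (R : realType) d (j : 'I_d) (V : set 'rV[R]_d.-1)
    (phi : 'rV[R]_d.-1 -> R) : set 'rV[R]_d :=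
  [set y | V (col' j y) /\ y ord0 j = phi (col' j y)].

(* [y *m Q] is the image of the row vector [y] under the rotation. *)
Definition rotation (R : realType) d (Q : 'M[R]_d) :=
  Q *m Q^T = 1%:M /\ \det Q = 1.

Definition C11_boundary (R : realType) d (A : set 'rV[R]_d) :=
  forall x, boundary A x ->
    exists (U : set 'rV[R]_d) (Q : 'M[R]_d) (j : 'I_d) (V : set 'rV[R]_d.-1)
      (phi : 'rV[R]_d.-1 -> R),
      [/\ nbhs x U, rotation Q, open V, C11_on V phi &
          [set y *m Q | y in boundary A `&` U] = graph_over j V phi].

Section probability.
Context {R : realType} {disp disp' : measure_display}.
Context {Omega : measurableType disp} {T : measurableType disp'}.
Variable P : probability Omega R.
Local Open Scope ereal_scope.

Definition mutually_independent (X : nat -> Omega -> T) :=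
  forall (J : {fset nat}) (B : nat -> set T),
    (forall i, measurable (B i)) ->
    P (\bigcap_(i in [set` J]) X i @^-1` B i) =
    \prod_(i <- J) P (X i @^-1` B i).

(* sigma(X_0, X_1, ...) *)
Definition sequence_sigma_algebra (X : nat -> Omega -> T) : set_system Omega :=
  <<s \bigcup_i preimage_set_system setT (X i) measurable >>.

Definition independent_of_sequence (Z : Omega -> nat) (X : nat -> Omega -> T) :=
  forall (C : set nat) (E : set Omega), sequence_sigma_algebra X E ->
    P (Z @^-1` C `&` E) = P (Z @^-1` C) * P E.

End probability.

Definition is_density (R : realType) d (nu : set 'rV[R]_d -> \bar R)
    (f : 'rV[R]_d -> R) :=
  [/\ measurable_fun setT f, (forall x, 0 <= f x) &
      forall B, measurable B -> nu B = (\int[lebesgue_rV d]_(x in B) (f x)%:E)%E].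

Definition measure_support (R : realType) (T : topologicalType)
    (nu : set T -> \bar R) : set T :=
  [set x | forall U, open U -> U x -> (0 < nu U)%E].

Section clusters.
Context {R : realType} {d : nat}.
Implicit Types (S : {fset 'rV[R]_d}) (r : R) (k : nat).

Definition geometric_graph S r : rel S :=
  [rel x y | (x != y) && (enorm (val x - val y) <= r)].

Definition components S r : {set {set S}} :=
  equivalence_partition (connect (geometric_graph r)) [set: S]%SET.

Definition nb_components k r S : nat :=
  #|[set C in components S r | #|C| == k]%SET|.

(* Indices start at 0; these are the first [Z w] terms of the sequence. *)
Definition first_points (Omega : Type) (X : nat -> Omega -> 'rV[R]_d)
    (Z : Omega -> nat) (w : Omega) : {fset 'rV[R]_d} :=
  [fset X i w | i in iota 0 (Z w)]%fset.

End clusters.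

(* Main.v *)
(* Only logarithmic asymptotics are needed, so the balls of radius r around the
   points may be replaced by balls around a deterministic net.

   Upper bound. Cover the interior of A by O(r^-d) balls of radius delta r. The
   points of such a ball lie in one component, and if it has k vertices then,
   after removal of k sub-balls of radius delta r, the concentric ball of radius
   (1 - delta) r contains no point, which has probability at most
   exp (- n nu (ball) + small). If the ball lies in A this is about
   exp (- n f0 theta r^d). Otherwise its centre is within 2 r of the boundary,
   only O(r^(1-d)) centres are, and by the C^{1,1} hypothesis A contains almost
   half of the ball. The gain of a factor r then beats the loss in the exponent:
   this is the condition on d (f0 - f1 / 2).

   Lower bound. Near a point where f is almost minimal take of the order of r^-d
   points at distance at least 2 r from one another, and for each of them the
   event that exactly one point falls in each of k tiny balls around it and no
   other point within (1 + delta) r. *)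
From HB Require Import structures.
Require Import Defs.
From mathcomp Require Import all_boot all_order all_algebra finmap.
From mathcomp Require Import all_classical all_reals all_analysis.
From mathcomp Require Import measurable_realfun ring lra.

Set Implicit Arguments.
Unset Strict Implicit.
Unset Printing Implicit Defensive.

Import Order.TTheory GRing.Theory Num.Theory.
Import numFieldNormedType.Exports.

Local Open Scope classical_set_scope.
Local Open Scope ring_scope.

(** * Euclidean balls and their volume *)

Section euclidean_norm.
Context {R : rcfType} {d : nat}.
Implicit Types x y : 'rV[R]_d.

(** Write s for [n * r ^+ d]. After division by [n] the counts r^-d and r^-(d-1) become 1/s and r/s,
    and factors polynomial in s disappear once logarithms are divided by s. The boundary term is
    controlled through r itself: since d ln r = ln s - ln n, the limsup hypothesis gives r <= exp (-
    theta s (f0 - f1/2) + o(s)), which turns exp (- theta s f1/2) into exp (- theta s f0). The entry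
    [f0] of the maximum has another purpose: it forces r to tend to 0, so that local estimates
    apply.

    Two properties of the boundary carry the geometry, and an interval has them too: it is covered
    by O(rho^-(d-1)) balls of radius rho, and near it almost a half-ball lies in [A] around each
    interior point. The second requires the centre to be interior, hence nets with centres in the
    covered set and samples placed in the interior almost surely.

    All probabilities come from one exact formula: fix the sample size and the indices of the points
    filling [k] cells, use independence, and sum the Poisson series. Empty regions are the case of
    no cells. *)

Lemma sum_sqr_ge0 x : 0 <= \sum_(i < d) x ord0 i ^+ 2.
Proof. by apply: sumr_ge0 => i _; exact: sqr_ge0. Qed.

Lemma enorm_ge0 x : 0 <= enorm x.
Proof. exact: sqrtr_ge0. Qed.

Lemma sqr_enorm x : enorm x ^+ 2 = \sum_(i < d) x ord0 i ^+ 2.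
Proof. by rewrite sqr_sqrtr// sum_sqr_ge0. Qed.

Lemma enormN x : enorm (- x) = enorm x.
Proof.
by rewrite /enorm; congr Num.sqrt; apply: eq_bigr => i _; rewrite mxE sqrrN.
Qed.

Lemma enormB x y : enorm (x - y) = enorm (y - x).
Proof. by rewrite -enormN opprB. Qed.

Lemma enormZ a x : enorm (a *: x) = `|a| * enorm x.
Proof.
rewrite -sqrtr_sqr -sqrtrM ?sqr_ge0// mulr_sumr; congr Num.sqrt.
by apply: eq_bigr => i _; rewrite mxE exprMn.
Qed.

Lemma enorm0 : enorm (0 : 'rV[R]_d) = 0.
Proof. by rewrite -(scale0r 0) enormZ normr0 mul0r. Qed.

Lemma coord_le_enorm x i : `|x ord0 i| <= enorm x.
Proof.
rewrite -sqrtr_sqr ler_sqrt ?sum_sqr_ge0//.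
by rewrite (bigD1 i)//= lerDl sumr_ge0// => j _; exact: sqr_ge0.
Qed.

Lemma enorm_eq0 x : (enorm x == 0) = (x == 0).
Proof.
apply/eqP/eqP => [x0|->]; last exact: enorm0.
apply/rowP => i; rewrite mxE; apply/eqP.
by rewrite -normr_le0 -x0 coord_le_enorm.
Qed.

(** The squares of |y| x_i - |x| y_i sum to 2 |x| |y| (|x| |y| - <x, y>); zero vectors are set apart
    so that the positive factor can be cancelled. *)
Lemma cauchy_schwarz x y :
  \sum_(i < d) x ord0 i * y ord0 i <= enorm x * enorm y.
Proof.
have [->|x0] := eqVneq x 0.
  by rewrite enorm0 mul0r big1// => i _; rewrite mxE mul0r.
have [->|y0] := eqVneq y 0.
  by rewrite enorm0 mulr0 big1// => i _; rewrite mxE mulr0.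
have a0 : 0 < enorm x by rewrite lt_def enorm_ge0 enorm_eq0 x0.
have b0 : 0 < enorm y by rewrite lt_def enorm_ge0 enorm_eq0 y0.
have : 0 <= \sum_(i < d) (enorm y * x ord0 i - enorm x * y ord0 i) ^+ 2.
  by apply: sumr_ge0 => i _; exact: sqr_ge0.
rewrite (eq_bigr (fun i => enorm y ^+ 2 * x ord0 i ^+ 2 +
   (enorm x ^+ 2 * y ord0 i ^+ 2 -
    2 * enorm x * enorm y * (x ord0 i * y ord0 i)))); last by move=> i _; ring.
rewrite big_split big_split /= sumrN -!mulr_sumr -!sqr_enorm.
set s := \sum_(i < d) _; set a := enorm x in a0 *; set b := enorm y in b0 *.
have ab0 : 0 < 2 * a * b by rewrite !mulr_gt0.
rewrite (_ : _ + _ = 2 * a * b * (a * b - s)); last by ring.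
by rewrite pmulr_rge0// subr_ge0.
Qed.

Lemma enorm_triangle x y : enorm (x + y) <= enorm x + enorm y.
Proof.
rewrite -(@ler_pXn2r _ 2)// ?nnegrE ?addr_ge0 ?enorm_ge0//.
rewrite sqr_enorm (eq_bigr (fun i => x ord0 i ^+ 2 +
  (y ord0 i ^+ 2 + 2 * (x ord0 i * y ord0 i)))); last first.
  by move=> i _; rewrite mxE; ring.
rewrite big_split big_split /= -mulr_sumr -!sqr_enorm.
by have := cauchy_schwarz x y; nra.
Qed.

Lemma enorm_dist_triangle z x y : enorm (x - y) <= enorm (x - z) + enorm (z - y).
Proof. by rewrite (_ : x - y = (x - z) + (z - y)) ?enorm_triangle// addrA subrK. Qed.

Lemma enorm_orthogonal (Q : 'M[R]_d) x : Q *m Q^T = 1%:M ->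
  enorm (x *m Q) = enorm x.
Proof.
move=> QQ; have E (z : 'rV[R]_d) : \sum_(i < d) z ord0 i ^+ 2 = (z *m z^T) ord0 ord0.
  by rewrite mxE; apply: eq_bigr => i _; rewrite mxE expr2.
by rewrite /enorm !E trmx_mul mulmxA -(mulmxA x) QQ mulmx1.
Qed.

Lemma enorm_le_sum x : enorm x <= \sum_(i < d) `|x ord0 i|.
Proof.
have s0 : 0 <= \sum_(i < d) `|x ord0 i| by apply: sumr_ge0.
rewrite -(@ler_pXn2r _ 2)// ?nnegrE ?enorm_ge0//.
rewrite sqr_enorm [leRHS]expr2 mulr_suml; apply: ler_sum => i _.
rewrite -[leLHS]ger0_norm ?sqr_ge0// expr2 normrM ler_wpM2l// (bigD1 i)//= lerDl.
exact: sumr_ge0.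
Qed.

Lemma enorm_le_coord x a : (forall i, `|x ord0 i| <= a) -> enorm x <= d%:R * a.
Proof.
move=> xa; apply: (le_trans (enorm_le_sum x)).
rewrite (@le_trans _ _ (\sum_(i < d) a))//; first by apply: ler_sum => i _.
by rewrite sumr_const card_ord mulr_natl.
Qed.

Lemma enorm_delta (j : 'I_d) : enorm (delta_mx ord0 j : 'rV[R]_d) = 1.
Proof.
rewrite /enorm (bigD1 j)//= big1 ?addr0 => [|i /negbTE ij].
  by rewrite mxE !eqxx expr1n sqrtr1.
by rewrite mxE ij andbF expr0n.
Qed.

End euclidean_norm.

(** * Comparison with the sup norm, and Euclidean balls as neighbourhoods *)

Section sup_norm.
Context {R : realType} {d : nat}.
Implicit Types x y : 'rV[R]_d.

Lemma coord_le_norm x i : `|x ord0 i| <= `|x|.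
Proof.
rewrite [leRHS]/Num.norm/= mx_normrE.
exact: (le_bigmax _ (fun ij => `|x ij.1 ij.2|) (ord0, i)).
Qed.

Lemma norm_le_coord x a : 0 <= a -> (forall i, `|x ord0 i| <= a) -> `|x| <= a.
Proof.
move=> a0 xa; rewrite [leLHS]/Num.norm/= mx_normrE.
by apply/bigmax_leP; split => // -[i j] _ /=; rewrite ord1.
Qed.

Lemma norm_lt_coord x a : 0 < a -> (forall i, `|x ord0 i| < a) -> `|x| < a.
Proof.
move=> a0 xa; rewrite [ltLHS]/Num.norm/= mx_normrE.
by apply/bigmax_ltP; split => // -[i j] _ /=; rewrite ord1.
Qed.

Lemma norm_le_enorm x : `|x| <= enorm x.
Proof. by apply: norm_le_coord (enorm_ge0 x) _ => i; exact: coord_le_enorm. Qed.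

Lemma enorm_le_norm x : enorm x <= d%:R * `|x|.
Proof. by apply: enorm_le_coord => i; exact: coord_le_norm. Qed.

Definition cball (c : 'rV[R]_d) (r : R) : set 'rV[R]_d :=
  [set x | enorm (x - c) <= r].

Lemma cball_center c r : 0 <= r -> cball c r c.
Proof. by rewrite /cball/= subrr enorm0. Qed.

Lemma cball_sub c c' r r' : enorm (c - c') + r <= r' -> cball c r `<=` cball c' r'.
Proof.
move=> rr' x /= xc; apply: le_trans (enorm_dist_triangle c _ _) _.
by rewrite addrC (le_trans _ rr')// lerD2l.
Qed.

Lemma nbhs_cball c r : 0 < r -> nbhs c (cball c r).
Proof.
move=> r0; apply/nbhs_ballP; exists (r / d.+1%:R); first by rewrite /= divr_gt0.
move=> x; rewrite -ball_normE /ball_ /= /cball /= => xc.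
rewrite enormB (le_trans (enorm_le_norm _))//.
rewrite (@le_trans _ _ (d%:R * (r / d.+1%:R))) ?ler_wpM2l//; first exact: ltW.
by rewrite mulrCA ler_piMr ?(ltW r0)// ler_pdivrMr// mul1r ler_nat.
Qed.

Lemma nbhs_cballP c (U : set 'rV[R]_d) :
  nbhs c U <-> exists2 r, 0 < r & cball c r `<=` U.
Proof.
split=> [/nbhs_ballP[e /= e0 eU]|[r r0 rU]].
  exists (e / 2); first by rewrite divr_gt0.
  move=> x xc; apply: eU; rewrite -ball_normE /ball_ /= distrC.
  apply: le_lt_trans (norm_le_enorm _) _; apply: le_lt_trans xc _.
  by rewrite ltr_pdivrMr// ltr_pMr// ltr1n.
exact: filterS rU (nbhs_cball c r0).
Qed.

End sup_norm.


(** * Lebesgue measure under dilations and translations *)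

Section affine.
Context {R : realType}.

Section line.
Variables (a c : R).

Definition affine1 (t : measurableTypeR R) : measurableTypeR R := a * t + c.

Lemma measurable_affine1 : measurable_fun setT affine1.
Proof. exact: measurable_funD. Qed.

HB.instance Definition _ :=
  @isMeasurableFun.Build _ _ _ _ affine1 measurable_affine1.

(** Lebesgue measure is determined by its values on the intervals []x, y]]. The signs of [a] are
    treated apart because a negative one moves the closed endpoint to the other side. *)
Lemma lebesgue_measure_affine1 (B : set R) : a != 0 -> measurable B ->
  lebesgue_measure B = (`|a|%:E * lebesgue_measure (affine1 @^-1` B))%E.
Proof.
move=> a0 mB; pose an := NngNum (normr_ge0 a).
have := @lebesgue_measure_unique R
  (mscale an (pushforward (@lebesgue_measure R) affine1)) _ B mB.
apply => _ [[x y] _ <-].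
change (lebesgue_measure `]x, y] =
  `|a|%:E * lebesgue_measure (affine1 @^-1` `]x, y]))%E.
have [a_lt0|a_gt0|/eqP] := ltgtP a 0; last by rewrite (negbTE a0).
- rewrite (_ : _ @^-1` _ = `[(y - c) / a, (x - c) / a[%classic); last first.
    apply/seteqP; split=> t /=; rewrite !in_itv /= /affine1.
      by rewrite ler_ndivrMr// ltr_ndivlMr// lerBrDr ltrBlDr mulrC andbC.
    by rewrite ler_ndivrMr// ltr_ndivlMr// lerBrDr ltrBlDr mulrC andbC.
  rewrite !lebesgue_measure_itv /= !lte_fin.
  rewrite ltr_ndivrMr// mulfVK// ltrD2r; case: ifP => xy; rewrite ?mule0//.
  rewrite -!EFinB -EFinM ltr0_norm//; congr (_%:E).
  by rewrite -mulrBl mulrCA mulNr mulfV//; ring.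
- rewrite (_ : _ @^-1` _ = `](x - c) / a, (y - c) / a]%classic); last first.
    apply/seteqP; split=> t /=; rewrite !in_itv /= /affine1.
      by rewrite ler_pdivlMr// ltr_pdivrMr// lerBrDr ltrBlDr mulrC.
    by rewrite ler_pdivlMr// ltr_pdivrMr// lerBrDr ltrBlDr mulrC.
  rewrite !lebesgue_measure_itv /= !lte_fin.
  rewrite ltr_pdivrMr// mulfVK// ltrD2r; case: ifP => xy; rewrite ?mule0//.
  rewrite -!EFinB -EFinM gtr0_norm//; congr (_%:E).
  by rewrite -mulrBl mulrCA mulfV//; ring.
Qed.

End line.

Section space.
Context {d : nat}.

Definition rV_box : set_system 'rV[R]_d :=
  [set B | exists2 I : 'I_d -> set R, (forall i, measurable (I i)) &
     B = [set x : 'rV[R]_d | forall i, I i (x ord0 i)]].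

Lemma measurable_coord_preimage (i : 'I_d) (I : set R) : measurable I ->
  measurable [set x : 'rV[R]_d | I (x ord0 i)].
Proof.
move=> mI; have := @measurable_rV_coord R d i measurableT I mI.
by rewrite setTI.
Qed.

Lemma measurable_rV_box (I : 'I_d -> set R) : (forall i, measurable (I i)) ->
  measurable [set x : 'rV[R]_d | forall i, I i (x ord0 i)].
Proof.
move=> mI; rewrite (_ : [set _ | _] = \bigcap_(i in @setT 'I_d)
   [set x : 'rV[R]_d | I i (x ord0 i)]).
  by apply: fin_bigcap_measurable => // i _; exact: measurable_coord_preimage.
by apply/seteqP; split => [x Ix i _|x Ix i]; [exact: Ix|exact: Ix].
Qed.

(** Boxes are stable under intersection, unlike the one-coordinate preimages that define the
    sigma-algebra, so uniqueness of measures can be applied to them. *)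
Lemma measurable_rV_boxE : @measurable _ 'rV[R]_d = <<s rV_box >>.
Proof.
apply/seteqP; split.
  apply: smallest_sub; first exact: smallest_sigma_algebra.
  move=> _ [i _ [B mB <-]]; apply: sub_sigma_algebra.
  exists (fun j => if j == i then B else setT).
    by move=> j; case: ifP => // _; exact: measurableT.
  apply/seteqP; split => [x [_ Bx] j|x Bx]; first by case: eqP => // ->.
  by split => //; have := Bx i; rewrite eqxx.
apply: smallest_sub; first exact: sigma_algebra_measurable.
by move=> _ [I mI ->]; exact: measurable_rV_box.
Qed.

Variables (a : R) (c : 'rV[R]_d).

Definition affine (x : 'rV[R]_d) : 'rV[R]_d := a *: x + c.

Lemma measurable_affine : measurable_fun setT affine.
Proof.
apply: measurable_fun_rV => i.
rewrite (_ : (fun _ => _) = fun x : 'rV[R]_d => a * x ord0 i + c ord0 i).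
  apply: measurable_funD => //.
  apply: (@measurable_funM _ _ _ _ (cst a)) => //.
  exact: measurable_rV_coord.
by apply/funext => x; rewrite !mxE.
Qed.

HB.instance Definition _ :=
  @isMeasurableFun.Build _ _ _ _ affine measurable_affine.

(** Both sides are measures in [B], so comparing them on boxes suffices, and there each coordinate
    contributes a factor [|a|]. The cubes [g k] exhaust the space with finite volume, as uniqueness
    requires. *)
Lemma lebesgue_rV_affine (B : set 'rV[R]_d) : a != 0 -> measurable B ->
  lebesgue_rV d B = ((`|a| ^+ d)%:E * lebesgue_rV d (affine @^-1` B))%E.
Proof.
move=> a0 mB; pose an := NngNum (exprn_ge0 d (normr_ge0 a)).
pose g (k : nat) := [set x : 'rV[R]_d | forall i, `]-k%:R, k%:R[%classic (x ord0 i)].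
have gfin k : (lebesgue_rV d (g k) < +oo)%E.
  rewrite /g (@lebesgue_rV_box R d (fun=> `]- k%:R, k%:R[%classic))//.
  rewrite (eq_bigr (fun=> (k%:R + k%:R)%:E)); last first.
    move=> i _; rewrite lebesgue_measure_itv /= lte_fin opprK.
    case: ltP => // k0; rewrite (_ : k%:R = 0 :> R) ?addr0//.
    by have := ler0n R k; lra.
  by rewrite prodEFin ltry.
have := @measure_unique _ R 'rV[R]_d rV_box g measurable_rV_boxE _ _ _
  (lebesgue_rV d) (mscale an (pushforward (lebesgue_rV d) affine)) _ _ B mB.
apply.
- move=> _ _ [I mI ->] [J mJ ->]; exists (fun i => I i `&` J i).
    by move=> i; exact: measurableI.
  apply/seteqP; split => [x [Ix Jx] i|x IJx]; first by split.
  by split => i; case: (IJx i).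
- by move=> k; exists (fun=> `]-k%:R, k%:R[%classic) => // i; exact: measurable_itv.
- apply/seteqP; split => // x _.
  exists (Num.bound `|x|) => // i /=; rewrite in_itv /= -ltr_norml.
  exact: le_lt_trans (coord_le_norm _ _) (archi_boundP (normr_ge0 x)).
- move=> _ [I mI ->].
  set J := [set _ | _]; change (lebesgue_rV d J =
    (`|a| ^+ d)%:E * lebesgue_rV d (affine @^-1` J))%E; rewrite {}/J.
  rewrite (_ : _ @^-1` _ = [set x : 'rV[R]_d | forall i,
     (affine1 a (c ord0 i) @^-1` I i) (x ord0 i)]); last first.
    by apply/seteqP; split => x Ix i; have := Ix i; rewrite /= /affine1 !mxE.
  rewrite (@lebesgue_rV_box R d I)//.
  rewrite (@lebesgue_rV_box R d (fun i => affine1 a (c ord0 i) @^-1` I i)); last first.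
    move=> i; rewrite -[_ @^-1` _]setTI.
    exact: (@measurable_affine1 a (c ord0 i) measurableT (I i) (mI i)).
  under eq_bigr => i _ do rewrite (@lebesgue_measure_affine1 a (c ord0 i))//.
  by rewrite big_split /= prodEFin prodr_const card_ord.
- exact: gfin.
Qed.

End space.

End affine.

Section balls.
Context {R : realType} {d : nat}.
Implicit Types (c : 'rV[R]_d) (r : R) (w : 'cV[R]_d).

Lemma measurable_rV_mul w : measurable_fun setT
  (fun x : 'rV[R]_d => (x *m w) ord0 ord0 : R).
Proof.
rewrite (_ : (fun _ => _) = fun x : 'rV[R]_d => \sum_i x ord0 i * w i ord0).
  apply: measurable_sum => i; apply: (@measurable_funM _ _ _ _ _ (cst _)) => //.
  exact: measurable_rV_coord.
by apply/funext => x; rewrite mxE.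
Qed.

Lemma measurable_cball0 r : measurable (cball (0 : 'rV[R]_d) r).
Proof.
have [r0|r0] := leP 0 r; last first.
  rewrite (_ : cball _ _ = set0)//; apply/seteqP; split => // x.
  by rewrite /cball/= => /(le_trans (enorm_ge0 _)); rewrite leNgt r0.
have mS : measurable_fun setT (fun x : 'rV[R]_d => \sum_(i < d) x ord0 i ^+ 2).
  apply: measurable_sum => i; apply: measurable_funX.
  exact: measurable_rV_coord.
have := mS measurableT _ (measurable_itv `]-oo, (r ^+ 2)]).
rewrite setTI; congr measurable; apply/seteqP; split => x;
  rewrite /cball /= in_itv/= subr0 -sqr_enorm.
  by rewrite ler_pXn2r// nnegrE enorm_ge0.
by rewrite ler_pXn2r// nnegrE enorm_ge0.
Qed.

Lemma affine_cball a c r : 0 < a ->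
  affine a c @^-1` cball c (a * r) = cball 0 r.
Proof.
move=> a0; apply/seteqP; split => x; rewrite /cball /affine /= addrK subr0 enormZ;
  by rewrite gtr0_norm// ler_pM2l.
Qed.

Lemma measurable_cball c r : measurable (cball c r).
Proof.
rewrite (_ : cball c r = affine 1 (- c) @^-1` cball 0 r).
  by rewrite -[_ @^-1` _]setTI; exact: measurable_affine (measurable_cball0 r).
by apply/seteqP; split => x; rewrite /cball /affine /= scale1r subr0.
Qed.

Definition half_cball c r w : set 'rV[R]_d :=
  cball c r `&` [set x | ((x - c) *m w) ord0 ord0 <= 0].

Lemma measurable_half_cball c r w : measurable (half_cball c r w).
Proof.
apply: measurableI; first exact: measurable_cball.
have := measurable_rV_mul w measurableT (measurable_itv `]-oo, ((c *m w) ord0 ord0)]).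
rewrite setTI; congr measurable; apply/seteqP; split => x /=;
  by rewrite in_itv/= mulmxBl !mxE subr_le0.
Qed.

Lemma lebesgue_cball0_fin : (lebesgue_rV d (cball (0 : 'rV[R]_d) 1) < +oo)%E.
Proof.
pose I (i : 'I_d) := `[(-1 : R), 1]%classic.
have mI i : measurable (I i) by exact: measurable_itv.
apply: (@le_lt_trans _ _ (lebesgue_rV d [set x : 'rV[R]_d | forall i, I i (x ord0 i)])).
  apply: le_measure; rewrite ?inE; [exact: measurable_cball|exact: measurable_rV_box|].
  move=> x; rewrite /cball/= subr0 => x1 i; rewrite /I /= in_itv /= -ler_norml.
  exact: le_trans (coord_le_enorm _ _) x1.
rewrite lebesgue_rV_box// (eq_bigr (fun=> 2%:E)) ?prodEFin ?ltry// => i _.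
by rewrite lebesgue_measure_itv /= lte_fin ifT ?opprK//; lra.
Qed.

Lemma unit_ball_volumeE : (unit_ball_volume R d)%:E =
  lebesgue_rV d (cball (0 : 'rV[R]_d) 1).
Proof.
rewrite /unit_ball_volume (_ : [set _ | _] = cball (0 : 'rV[R]_d) 1).
  by rewrite fineK// ge0_fin_numE ?measure_ge0// lebesgue_cball0_fin.
by apply/seteqP; split => x; rewrite /cball /= subr0.
Qed.

Lemma unit_ball_volume_gt0 : 0 < unit_ball_volume R d.
Proof.
rewrite -lte_fin unit_ball_volumeE.
(* The cube of half-side [a] lies in the unit ball, the norm being at most [d] times the largest
   coordinate. *)
pose a : R := d.+1%:R^-1; have a0 : 0 < a by rewrite invr_gt0.
pose I (i : 'I_d) := `[- a, a]%classic.
have mI i : measurable (I i) by exact: measurable_itv.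
apply: (@lt_le_trans _ _ (lebesgue_rV d [set x : 'rV[R]_d | forall i, I i (x ord0 i)])).
  rewrite lebesgue_rV_box// (eq_bigr (fun=> (a + a)%:E)).
    by rewrite prodEFin lte_fin prodr_gt0// => i _; rewrite addr_gt0.
  move=> i _; rewrite lebesgue_measure_itv /= lte_fin ifT ?opprK//; lra.
apply: le_measure; rewrite ?inE; [exact: measurable_rV_box|exact: measurable_cball|].
move=> x /= Ix; rewrite /cball/= subr0.
apply: (le_trans (@enorm_le_coord _ _ _ a _)).
  by move=> i; have := Ix i; rewrite /I /= in_itv /= ler_norml.
by rewrite ler_pdivrMr// mul1r ler_nat.
Qed.

Lemma lebesgue_cball c r : 0 < r ->
  lebesgue_rV d (cball c r) = (unit_ball_volume R d * r ^+ d)%:E.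
Proof.
move=> r0; rewrite (@lebesgue_rV_affine _ _ r c) ?gt_eqF//; last exact: measurable_cball.
rewrite -[X in cball c X]mulr1 affine_cball// EFinM unit_ball_volumeE.
by rewrite gtr0_norm// muleC.
Qed.

(** The reflection [x |-> c + c - x] exchanges the half-balls of [w] and [- w], which together cover
    the ball. *)
Lemma lebesgue_half_cball c r w : 0 < r ->
  ((unit_ball_volume R d * r ^+ d / 2)%:E <= lebesgue_rV d (half_cball c r w))%E.
Proof.
move=> r0.
have hE : lebesgue_rV d (half_cball c r (- w)) = lebesgue_rV d (half_cball c r w).
  rewrite (@lebesgue_rV_affine _ _ (-1) (c + c)) ?oppr_eq0 ?oner_eq0//; last first.
    exact: measurable_half_cball.
  rewrite normrN normr1 expr1n mul1e; congr (lebesgue_rV d _).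
  have E x : affine (-1) (c + c) x - c = - (x - c).
    by rewrite /affine scaleN1r addrA addrK opprB addrC.
  by apply/seteqP; split => x [xr xw]; split; move: xr xw;
    rewrite /cball /= E ?enormN// mulNmx mulmxN opprK.
have : (lebesgue_rV d (cball c r) <=
   lebesgue_rV d (half_cball c r w) + lebesgue_rV d (half_cball c r (- w)))%E.
  apply: (le_trans _ (measureU2 _ _ _)); try exact: measurable_half_cball.
  apply: le_measure; rewrite ?inE; [exact: measurable_cball| |].
    by apply: measurableU; exact: measurable_half_cball.
  move=> x xr; have [?|/ltW ?] := leP (((x - c) *m w) ord0 ord0) 0; [left|right] => //.
  by split => //=; rewrite mulmxN mxE oppr_le0.
rewrite hE lebesgue_cball//; move: (lebesgue_rV d _) => [v| |]//=; rewrite ?leey//.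
by rewrite -EFinD !lee_fin; lra.
Qed.

End balls.

(** * Borel sets, supports and densities *)

Section rational_boxes.
Context {R : realType} {d : nat}.

(** Rational centres and inverse-integer radii give a countable base of the topology. Countability
    makes open sets measurable and lets null neighbourhoods be assembled. *)
Definition rational_box (p : 'rV[rat]_d * nat) : set 'rV[R]_d :=
  [set x | forall i,
    `](ratr (p.1 ord0 i) - p.2.+1%:R^-1), (ratr (p.1 ord0 i) + p.2.+1%:R^-1)[%classic
      (x ord0 i)].

Definition box_enum (n : nat) : set 'rV[R]_d :=
  if choice.unpickle n is Some p then rational_box p else set0.

Lemma measurable_box_enum n : measurable (box_enum n).
Proof.
rewrite /box_enum; case: choice.unpickle => [p|]; last exact: measurable0.
apply: (@measurable_rV_box R d (fun i => `](ratr (p.1 ord0 i) - p.2.+1%:R^-1),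
  (ratr (p.1 ord0 i) + p.2.+1%:R^-1)[%classic)) => i.
exact: measurable_itv.
Qed.

Lemma nbhs_box_enum (x : 'rV[R]_d) (U : set 'rV[R]_d) : nbhs x U ->
  exists n, box_enum n x /\ box_enum n `<=` U.
Proof.
move=> /nbhs_ballP[e /= e0 eU].
have [m me] : exists m, m.+1%:R^-1 < e / 2.
  have e2 : 0 < e / 2 by rewrite divr_gt0.
  exists (Num.bound (e / 2)^-1); rewrite invf_plt ?posrE//.
  have := archi_boundP (ltW (_ : 0 < (e / 2)^-1)); rewrite invr_gt0 => /(_ e2).
  by move=> /lt_le_trans; apply; rewrite ler_nat.
have m0 : 0 < m.+1%:R^-1 :> R by rewrite invr_gt0.
pose a : R := m.+1%:R^-1; rewrite -/a in me m0.
have rq (i : 'I_d) : exists q : rat, x ord0 i - a < ratr q < x ord0 i + a.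
  have /rat_in_itvoo[q] : x ord0 i - a < x ord0 i + a by lra.
  by rewrite in_itv /=; exists q.
have [q qP] := choice rq.
exists (choice.pickle (\row_i q i, m)); rewrite /box_enum choice.pickleK; split.
  by move=> i; rewrite /= in_itv /= !mxE -/a; have := qP i; lra.
move=> y yq; apply: eU; rewrite -ball_normE /ball_ /=.
apply: norm_lt_coord => // i; rewrite !mxE ltr_norml.
by have := yq i; rewrite /= in_itv /= !mxE -/a; have := qP i; lra.
Qed.

Lemma measurable_open_rV (U : set 'rV[R]_d) : open U -> measurable U.
Proof.
move=> oU; rewrite (_ : U = \bigcup_(n in [set n | box_enum n `<=` U]) box_enum n).
  by apply: bigcup_measurable => n _; exact: measurable_box_enum.
apply/seteqP; split => [x Ux|x [n /= nU]]; last exact: nU.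
have [|n [nx nU]] := @nbhs_box_enum x U; last by exists n.
exact: open_nbhs_nbhs.
Qed.

Lemma measurable_closed_rV (U : set 'rV[R]_d) : closed U -> measurable U.
Proof.
move=> cU; rewrite -[U]setCK; apply: measurableC; apply: measurable_open_rV.
by rewrite openC.
Qed.

(** A point off the support has a null open neighbourhood, hence lies in a null box of the countable
    base. *)
Lemma measure_support_compl (nu : {measure set 'rV[R]_d -> \bar R}) :
  nu.-negligible (~` measure_support nu).
Proof.
pose F n := if nu (box_enum n) == 0%E then box_enum n else set0.
apply: (@negligibleS _ _ _ _ (\bigcup_n F n)); last first.
  apply: negligible_bigcup => n; rewrite /F; case: ifPn => [/eqP n0|_].
    by apply/negligibleP => //; exact: measurable_box_enum.
  exact: negligible_set0.
move=> x /existsNP[U /not_implyP[oU /not_implyP[Ux /negP]]].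
rewrite -leNgt => U0; have [|n [nx nU]] := @nbhs_box_enum x U.
  exact: open_nbhs_nbhs.
exists n => //; rewrite /F ifT// -measure_le0; apply: le_trans U0.
by rewrite le_measure ?inE//; [exact: measurable_box_enum|exact: measurable_open_rV].
Qed.

End rational_boxes.

Section density.
Context {R : realType} {d : nat} (nu : probability 'rV[R]_d R) (f : 'rV[R]_d -> R).
Hypothesis nu_density : is_density nu f.
Local Open Scope ereal_scope.

Let mf : measurable_fun setT f. Proof. by case: nu_density. Qed.
Let f_ge0 x : (0 <= f x)%R. Proof. by case: nu_density. Qed.
Let nuE B : measurable B -> nu B = \int[lebesgue_rV d]_(x in B) (f x)%:E.
Proof. by case: nu_density => _ _; exact. Qed.

Let mEf B : measurable B -> measurable_fun B (EFin \o f).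
Proof. by move=> mB; apply/measurable_EFinP; exact: measurable_funTS. Qed.

Lemma density_ge m B : measurable B -> (0 <= m)%R -> (forall x, B x -> m <= f x)%R ->
  m%:E * lebesgue_rV d B <= nu B.
Proof.
move=> mB m0 mf'; rewrite nuE// -integral_cst//.
by apply: ge0_le_integral => //; [exact: mEf].
Qed.

Lemma density_null B : measurable B -> lebesgue_rV d B = 0 -> nu B = 0.
Proof. by move=> mB B0; rewrite nuE//; apply: null_set_integral => //; exact: mEf. Qed.

(** [f] is bounded only on [A], so the part of [B] outside [A] is first discarded as [nu]-null. *)
Lemma density_le M A B : measurable A -> measurable B -> nu.-negligible (~` A) ->
  (0 <= M)%R -> (forall x, A x -> B x -> f x <= M)%R ->
  nu B <= M%:E * lebesgue_rV d B.
Proof.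
move=> mA mB A0 M0 fM; have mAB : measurable (B `&` A) by exact: measurableI.
have -> : nu B = nu (B `&` A).
  apply/eqP; rewrite eq_le; apply/andP; split; last first.
    by rewrite le_measure ?inE.
  apply: (@le_trans _ _ (nu (B `&` A) + nu (~` A))).
    apply: (le_trans _ (measureU2 _ _ _)) => //; last exact: measurableC.
    rewrite le_measure ?inE//; first by apply: measurableU => //; exact: measurableC.
    by move=> x Bx; have [Ax|Ax] := pselect (A x); [left|right].
  by move/negligibleP: A0 => ->; rewrite ?adde0//; exact: measurableC.
apply: (@le_trans _ _ (M%:E * lebesgue_rV d (B `&` A))).
  rewrite nuE// -integral_cst//.
  apply: ge0_le_integral => //; [by move=> x _; rewrite lee_fin|exact: mEf|by move=> x [Bx Ax]; rewrite lee_fin fM].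
by rewrite lee_wpmul2l ?lee_fin// le_measure ?inE.
Qed.

End density.

(** * Coverings *)

Section coverings.
Context {R : realType} {d : nat}.
Implicit Types (S K : set 'rV[R]_d) (rho : R) (s : seq 'rV[R]_d) (p : nat).

(** The centres lie in [S] because the mass estimates near the boundary are available only for balls
    centred in the interior of [A]. *)
Definition net S rho s :=
  (forall c, c \in s -> S c) /\
  (forall x, S x -> exists2 c, c \in s & enorm (x - c) <= rho).

(** A centre whose ball meets [S] is replaced by a point of [S] in that ball and the others are
    dropped; this doubles the radius. *)
Lemma net_recenter S rho s :
  (forall x, S x -> exists2 c, c \in s & enorm (x - c) <= rho) ->
  exists2 s', net S (rho + rho) s' & (size s' <= size s)%N.
Proof.
move=> Ss; pose F c := S `&` cball c rho.
exists [seq xget c (F c) | c <- s & `[< F c !=set0 >]]; last first.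
  by rewrite size_map size_filter count_size.
split=> [c /mapP[b]|x Sx].
  by rewrite mem_filter => /andP[/asboolP[y Fy] _] ->; have [] := xgetPex b (ex_intro _ _ Fy).
have [c cs xc] := Ss x Sx.
have Fc : F c !=set0 by exists x.
exists (xget c (F c)).
  by apply/mapP; exists c => //; rewrite mem_filter cs andbT; apply/asboolP.
have [_ yc] := xgetPex c Fc.
by apply: le_trans (enorm_dist_triangle c _ _) _; rewrite lerD// enormB.
Qed.

(* An upper Minkowski dimension bound, with centres taken in the set. *)
Definition coverable S p := exists2 C : R, 0 < C &
  forall rho, 0 < rho -> rho <= 1 ->
    exists2 s, net S rho s & (size s)%:R <= C * rho^-1 ^+ p.

(** The last hypothesis says that [pi] has an [L]-Lipschitz inverse on its image, which lies in the
    cube [[-D, D]^m]. Cut this cube into cells of side [rho / L] and keep one point of [S] over each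
    occupied cell: at most [(2 D L / rho + 1)^m] points. *)
Lemma coverable_lip m (pi : 'rV[R]_d -> 'rV[R]_m) (D L : R) S :
  0 < D -> 0 < L ->
  (forall y i, S y -> `|pi y ord0 i| <= D) ->
  (forall y y', S y -> S y' -> enorm (y - y') <= L * `|pi y - pi y'|) ->
  coverable S m.
Proof.
move=> D0 L0 SD SL; exists ((2 * D * L + 1) ^+ m).
  by rewrite exprn_gt0// addr_gt0// !mulr_gt0.
move=> rho rho0 rho1; pose M := Num.truncn (2 * D * L / rho).
pose t y i := (pi y ord0 i + D) / (rho / L).
have h0 : 0 < rho / L by rewrite divr_gt0.
have t0 y i : S y -> 0 <= t y i.
  by move=> Sy; rewrite divr_ge0// ?(ltW h0)//; have := SD y i Sy; rewrite ler_norml; lra.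
have tM y i : S y -> (Num.truncn (t y i) < M.+1)%N.
  move=> Sy; rewrite ltnS; apply: le_truncn; rewrite ler_pdivrMr//.
  rewrite mulrA mulfVK ?gt_eqF// mulfK ?gt_eqF//.
  by have := SD y i Sy; rewrite ler_norml; lra.
pose idx y : {ffun 'I_m -> 'I_M.+1} := [ffun i => inord (Num.truncn (t y i))].
pose F (a : {ffun 'I_m -> 'I_M.+1}) := [set y | S y /\ idx y = a].
exists [seq xget 0 (F a) | a <- enum {: {ffun 'I_m -> 'I_M.+1}} & `[< F a !=set0 >]].
  split=> [c /mapP[a]|x Sx].
    by rewrite mem_filter => /andP[/asboolP[y Fy] _] ->; have [] := xgetPex 0 (ex_intro _ _ Fy).
  have Fx : F (idx x) !=set0 by exists x.
  exists (xget 0 (F (idx x))).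
    by apply/mapP; exists (idx x) => //; rewrite mem_filter mem_enum andbT; apply/asboolP.
  set y := xget _ _; have [Sy yx] : F (idx x) y by exact: xgetPex.
  apply: le_trans (SL _ _ Sx Sy) _; rewrite -ler_pdivlMl// mulrC.
  apply: norm_le_coord (ltW h0) _ => i; rewrite !mxE.
  have /(congr1 val) : idx y i = idx x i by rewrite yx.
  rewrite !ffunE /= !inordK ?tM// => E.
  have := truncn_itv (t0 _ i Sy); rewrite E => /andP[y1 y2].
  have /andP[x1 x2] := truncn_itv (t0 _ i Sx).
  have : `|t x i - t y i| <= 1 by rewrite ler_norml; move: x2 y2; rewrite -!natr1; lra.
  rewrite /t -mulrBl normrM [X in _ * X]gtr0_norm ?invr_gt0// ler_pdivrMr// mul1r.
  by rewrite opprD addrACA subrr addr0.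
rewrite size_map size_filter.
apply: (@le_trans _ _ (M.+1%:R ^+ m)).
  rewrite -natrX ler_nat (leq_trans (count_size _ _))// -cardE.
  by rewrite card_ffun !card_ord.
rewrite -exprMn lerXn2r ?nnegrE ?ler0n//.
  by rewrite mulr_ge0 ?invr_ge0 ?(ltW rho0)// addr_ge0// !mulr_ge0// ltW.
rewrite -natr1 mulrDl mul1r; have : 1 <= rho^-1 by rewrite invf_ge1.
have : M%:R <= 2 * D * L / rho.
  by rewrite truncn_le divr_ge0 ?(ltW rho0)// !mulr_ge0// ltW.
lra.
Qed.

Lemma coverable0 p : coverable set0 p.
Proof.
exists 1 => // rho rho0 _; exists [::]; first by split.
by rewrite mul1r exprn_ge0// invr_ge0 ltW.
Qed.

Lemma coverableU S1 S2 p : coverable S1 p -> coverable S2 p -> coverable (S1 `|` S2) p.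
Proof.
move=> [C1 C10 H1] [C2 C20 H2]; exists (C1 + C2); first exact: addr_gt0.
move=> rho rho0 rho1; have [s1 [S1s s1S] N1] := H1 _ rho0 rho1.
have [s2 [S2s s2S] N2] := H2 _ rho0 rho1; exists (s1 ++ s2).
  split=> [c|x]; first by rewrite mem_cat => /orP[/S1s|/S2s]; [left|right].
  by move=> [/s1S|/s2S] [c cs xc]; exists c => //; rewrite mem_cat cs ?orbT.
by rewrite size_cat natrD mulrDl lerD.
Qed.

Lemma coverable_compact K p : compact K ->
  (forall x, K x -> exists2 rho, 0 < rho & coverable (K `&` cball x rho) p) ->
  coverable K p.
Proof.
move=> cK locK.
have {}locK x : exists rho, K x -> 0 < rho /\ coverable (K `&` cball x rho) p.
  have [Kx|?] := pselect (K x); last by exists 0.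
  by have [rho ? ?] := locK x Kx; exists rho.
have [rho rhoP] := choice locK.
move: cK; rewrite compact_cover => /(_ _ K (fun x => interior (cball x (rho x)))).
case=> [x _|x Kx|D DK KD]; first exact: open_interior.
  by exists x => //; have [r0 _] := rhoP x Kx; exact: nbhs_cball.
suff [S [SK KS]] : exists S, coverable S p /\ K = S by rewrite KS.
exists (\bigcup_(x in [set` D]) (K `&` cball x (rho x))); split; last first.
  apply/seteqP; split => [y Ky|y [x _ []]]//.
  have [x xD /interior_subset yx] := KD _ Ky; by exists x.
have : forall x, x \in (D : seq _) -> K x by move=> x /DK; rewrite inE.
rewrite (_ : [set` D] = [set` (enum_fset D)])//; elim: (enum_fset D) => [_|x s IH sK].
  by rewrite set_nil bigcup_set0; exact: coverable0.
rewrite (_ : \bigcup_(y in _) _ = (K `&` cball x (rho x)) `|`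
    \bigcup_(y in [set` s]) (K `&` cball y (rho y))); last first.
  apply/seteqP; split => [y [z /=]|y [?|[z /= zs ?]]].
  - by rewrite inE => /orP[/eqP -> ?|zs ?]; [left|right; exists z].
  - by exists x => //=; rewrite mem_head.
  - by exists z => //=; rewrite inE zs orbT.
apply: coverableU.
  by have [] := rhoP x (sK _ (mem_head _ _)).
by apply: IH => y ys; apply: sK; rewrite inE ys orbT.
Qed.

Lemma coverable_bounded S D : 0 < D -> S `<=` cball 0 D -> coverable S d.
Proof.
move=> D0 SD; apply: (@coverable_lip d id D d.+1%:R) => //.
  move=> y i /SD; rewrite /cball /= subr0; apply: le_trans.
  exact: coord_le_enorm.
move=> y y' _ _; apply: le_trans (enorm_le_norm _) _.
by rewrite ler_wpM2r// ler_nat.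
Qed.

Lemma measure_le_sum (mu : {measure set 'rV[R]_d -> \bar R}) (I : eqType)
    (s : seq I) (F : I -> set 'rV[R]_d) S :
  measurable S -> (forall i, measurable (F i)) ->
  (forall x, S x -> exists2 i, i \in s & F i x) ->
  (mu S <= \sum_(i <- s) mu (F i))%E.
Proof.
move=> mS mF; elim: s S mS => [|i s IH] S mS Ss.
  rewrite (_ : S = set0) ?measure0 ?big_nil//.
  by apply/seteqP; split => // x /Ss[].
rewrite big_cons; apply: (@le_trans _ _ (mu (F i) + mu (S `\` F i)))%E.
  apply: (le_trans _ (measureU2 _ _ _)) => //; last exact: measurableD.
  rewrite le_measure ?inE//; first by apply: measurableU => //; exact: measurableD.
  by move=> x Sx; have [?|?] := pselect (F i x); [left|right].
rewrite leeD2l//; apply: IH; first exact: measurableD.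
move=> x [/Ss[j]]; rewrite inE => /orP[/eqP->//|js Fj _].
by exists j.
Qed.

(** The [C rho^-p] balls have total volume at most [C theta rho^(d-p)], hence at most [C theta rho]
    for [rho <= 1]. *)
Lemma coverable_null S p : measurable S -> (p < d)%N -> coverable S p ->
  lebesgue_rV d S = 0%E.
Proof.
move=> mS pd [C C0 SC].
have th0 := @unit_ball_volume_gt0 R d.
suff H (e : R) : 0 < e -> (lebesgue_rV d S <= e%:E)%E.
  apply/eqP; rewrite -measure_le0; apply/lee_addgt0Pr => e e0.
  by rewrite add0e; exact: H.
move=> e0; pose rho := Num.min 1 (e / (C * unit_ball_volume R d)).
have rho0 : 0 < rho by rewrite lt_min ltr01 divr_gt0// mulr_gt0.
have rho1 : rho <= 1 by rewrite ge_min lexx.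
have [s [_ sS] sC] := SC rho rho0 rho1.
apply: le_trans (measure_le_sum (F := fun c => cball c rho) _ mS _ sS) _.
  by move=> c; exact: measurable_cball.
rewrite (eq_bigr (fun=> (unit_ball_volume R d * rho ^+ d)%:E)); last first.
  by move=> c _; exact: lebesgue_cball.
rewrite sumEFin lee_fin big_const_seq count_predT iter_addr_0 -mulr_natr.
set th := unit_ball_volume R d.
apply: (@le_trans _ _ (th * rho ^+ d * (C * rho^-1 ^+ p))).
  by rewrite ler_wpM2l// mulr_ge0 ?exprn_ge0 ?(ltW rho0) ?(ltW th0).
rewrite (_ : _ * _ = C * th * rho ^+ (d - p)); last first.
  rewrite -[in rho ^+ d](subnK (ltnW pd)) exprD exprVn.
  by field; rewrite expf_neq0// gt_eqF.
apply: (@le_trans _ _ (C * th * rho)).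
  rewrite ler_wpM2l ?mulr_ge0 ?(ltW C0) ?(ltW th0)// -[leRHS]expr1.
  by rewrite ler_wiXn2l ?(ltW rho0)// subn_gt0.
rewrite mulrC -ler_pdivlMr ?mulr_gt0// /rho ge_min lexx orbT//.
Qed.

End coverings.

(** If the segment avoided the boundary, the parameters sent to the interior of [A] would be those
    sent to its closure: a nonempty, open and closed part of [[0, 1]], hence all of it, including
    the end [y]. *)
Lemma segment_boundary (R : realType) (d : nat) (A : set 'rV[R]_d) (x y : 'rV[R]_d) :
  A x -> ~ A y -> exists t, [/\ 0 <= t, t <= 1 & boundary A (x + t *: (y - x))].
Proof.
move=> Ax Ay; apply: contrapT => noB; pose p (t : R) := x + t *: (y - x).
have cp : continuous p.
  move=> t; apply: cvgD; first exact: cvg_cst.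
  by apply: cvgZr_tmp; exact: cvg_id.
have AE t : `[0, 1]%classic t -> closure A (p t) -> interior A (p t).
  rewrite /= in_itv /= => /andP[t0 t1] cA; apply: contrapT => iA; apply: noB.
  by exists t; split.
have : `[0, 1]%classic `&` p @^-1` interior A = `[0, 1]%classic.
  apply: (@segment_connected R 0 1).
  - exists 0; have h0 : `[0, 1]%classic (0 : R) by rewrite /= in_itv /= lexx ler01.
    split => //; apply: AE => //; rewrite /p scale0r addr0; exact: subset_closure.
  - exists (p @^-1` interior A) => //; apply: open_comp => //; exact: open_interior.
  - exists (p @^-1` closure A).
      by apply: preimage_closed => //; exact: closed_closure.
    apply/seteqP; split => t [t01 ?]; split => //; last exact: AE.
    by apply: subset_closure; exact: interior_subset.
move/seteqP => [_ /(_ 1)]; case; first by rewrite /= in_itv /= ler01 lexx.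
by rewrite /p /= scale1r addrC subrK => _ /interior_subset.
Qed.

(** * Boundaries of class C11 *)

Section taylor.
Context {R : realType} {m : nat}.
Implicit Types (V : set 'rV[R]_m) (phi : 'rV[R]_m -> R) (u v w : 'rV[R]_m).

Lemma derive_rV_sum phi u w : differentiable phi u ->
  'D_w phi u = \sum_i w ord0 i * 'D_(delta_mx ord0 i) phi u.
Proof.
move=> dphi; rewrite deriveE// [w in LHS]row_sum_delta linear_sum.
by apply: eq_bigr => i _; rewrite linearZ deriveE.
Qed.

Lemma rV_mean_value phi u w :
  (forall t : R, 0 <= t <= 1 -> differentiable phi (u + t *: w)) ->
  exists2 t, 0 <= t <= 1 & phi (u + w) - phi u =
    \sum_i w ord0 i * 'D_(delta_mx ord0 i) phi (u + t *: w).
Proof.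
move=> dphi; pose g (t : R) : R := phi (u + t *: w).
(* Difference quotients of [g] are those of [phi] along [w], so derivability and derivative transfer
   without a chain rule. *)
have gE t : (fun h => h^-1 *: ((g \o shift t) (h *: 1) - g t)) =
    (fun h => h^-1 *: ((phi \o shift (u + t *: w)) (h *: w) - phi (u + t *: w))).
  apply/funext => h; rewrite /g /=; congr (_ *: (phi _ - _)).
  by rewrite scalerDl addrCA [h%:A]mulr1.
have gD (t : R) : 0 <= t <= 1 -> is_derive t 1 g ('D_w phi (u + t *: w)).
  move=> t01; split; last by rewrite /derive gE.
  by rewrite /derivable gE; exact/diff_derivable/dphi.
have [|||c c01] := @MVT R g (fun t => 'D_w phi (u + t *: w)) 0 1.
- exact: ltr01.
- by move=> t; rewrite in_itv /= => /andP[t0 t1]; apply: gD; rewrite !ltW.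
- apply: derivable_within_continuous => t; rewrite in_itv /= => t01.
  by have [] := gD t t01.
rewrite /g scale1r scale0r addr0 subr0 mulr1 => ->.
have c01' : 0 <= c <= 1 by move: c01; rewrite in_itv /= => /andP[? ?]; rewrite !ltW.
by exists c => //; rewrite derive_rV_sum//; exact: dphi.
Qed.

(** By the mean value theorem the increment is the gradient at an intermediate point applied to
    [v - u]. Boundedness of the gradient gives the first estimate, its Lipschitz continuity the
    second. *)
Lemma C11_taylor V phi u0 : open V -> V u0 -> C11_on V phi ->
  exists K rho, [/\ 0 < K, 0 < rho, rho <= 1 &
    forall u v, `|u - u0| < rho -> `|v - u0| < rho ->
    [/\ V u, `|phi v - phi u| <= K * `|v - u| &
    `|phi v - phi u - \sum_i (v - u) ord0 i * 'D_(delta_mx ord0 i) phi u|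
      <= K * `|v - u| ^+ 2]].
Proof.
move=> oV Vu0 [dphi Lphi].
have [rho' rho'0 rhoV] : exists2 e : R, 0 < e & forall u, `|u - u0| < e -> V u.
  have /nbhs_ballP[e /= e0 eV] := open_nbhs_nbhs (conj oV Vu0).
  by exists e => // u ue; apply: eV; rewrite -ball_normE /ball_ /= distrC.
have Lex (i : 'I_m) : exists k : R, 0 <= k /\ forall u v, V u -> V v ->
    `|'D_(delta_mx ord0 i) phi u - 'D_(delta_mx ord0 i) phi v| <= k * `|u - v|.
  have [k [k0 kP]] := filter_ex (filterI (nbhs_pinfty_ge (num_real 0)) (Lphi i)).
  by exists k; split => // u v Vu Vv; exact: (kP (u, v)).
have [k kP] := choice Lex.
(* One constant for both estimates: Lipschitz constants of the partial derivatives plus their sizes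
   at [u0]. As [rho <= 1], it also bounds the partial derivatives near [u0]. Adding 1 makes it
   positive. *)
pose K := \sum_i (k i + `|'D_(delta_mx ord0 i) phi u0|).
have k0 i : 0 <= k i by have [] := kP i.
have K0 : 0 <= K by apply: sumr_ge0 => i _; rewrite addr_ge0.
pose rho := Num.min 1 rho'.
have rho0 : 0 < rho by rewrite lt_min ltr01.
exists (K + 1), rho; split => //; [lra|by rewrite ge_min lexx|].
move=> u v uu0 vu0; have rr : rho <= rho' by rewrite ge_min lexx orbT.
have r1 : rho <= 1 by rewrite ge_min lexx.
have cvx (t : R) : 0 <= t <= 1 -> `|u + t *: (v - u) - u0| < rho.
  move=> /andP[t0 t1].
  rewrite (_ : _ - u0 = (1 - t) *: (u - u0) + t *: (v - u0)); last first.
    by apply/rowP => i; rewrite !mxE; ring.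
  apply: le_lt_trans (ler_normD _ _) _; rewrite !normrZ !ger0_norm ?subr_ge0//.
  have [->|t0'] := eqVneq t 0; first by rewrite subr0 mul1r mul0r addr0.
  rewrite (_ : rho = (1 - t) * rho + t * rho); last by ring.
  by rewrite ler_ltD ?ler_wpM2l ?subr_ge0 ?(ltW uu0)// ltr_pM2l// lt_def t0' t0.
have Vt (t : R) : 0 <= t <= 1 -> V (u + t *: (v - u)).
  by move=> t01; apply: rhoV; apply: lt_le_trans rr; exact: cvx.
have Vu : V u by apply: rhoV; exact: lt_le_trans rr.
have [t t01 ->] : exists2 t, 0 <= t <= 1 & phi v - phi u =
    \sum_i (v - u) ord0 i * 'D_(delta_mx ord0 i) phi (u + t *: (v - u)).
  have [|t t01] := @rV_mean_value phi u (v - u).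
    by move=> t t01; apply: dphi; exact: Vt.
  by rewrite (addrC u) subrK => E; exists t.
split => //.
  rewrite (@le_trans _ _ (K * `|v - u|))//; last by rewrite ler_wpM2r//; lra.
  apply: le_trans (ler_norm_sum _ _ _) _; rewrite /K mulr_suml.
  apply: ler_sum => i _; rewrite normrM mulrC.
  apply: ler_pM => //; last exact: coord_le_norm.
  have := (kP i).2 _ _ (Vt t t01) (rhoV _ (lt_le_trans _ rr)).
  move=> /(_ u0); rewrite subrr normr0 => /(_ rho0) H.
  set a := 'D_(_) phi _ in H *; set b := 'D_(_) phi u0 in H *.
  rewrite -(subrK b a) (le_trans (ler_normD _ _))// lerD2r.
  apply: le_trans H _; rewrite ler_piMr// (le_trans (ltW (cvx t t01)))//.
rewrite -sumrB; apply: le_trans (ler_norm_sum _ _ _) _.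
rewrite (@le_trans _ _ (K * `|v - u| ^+ 2))//; last first.
  by rewrite ler_wpM2r ?exprn_ge0//; lra.
rewrite /K mulr_suml; apply: ler_sum => i _; rewrite -mulrBr normrM expr2 mulrCA.
apply: ler_pM => //; first exact: coord_le_norm.
apply: le_trans ((kP i).2 _ _ (Vt t t01) Vu) _.
rewrite addrAC subrr add0r normrZ; case/andP: t01 => t0 t1; rewrite ger0_norm//.
apply: ler_pM => //; first exact: mulr_ge0.
  by rewrite lerDl.
by rewrite ler_piMl.
Qed.

End taylor.

Section chart.
Context {R : realType} {m : nat}.
Implicit Types (A : set 'rV[R]_m.+1) (x y z : 'rV[R]_m.+1).

Lemma norm_col'_le (j : 'I_m.+1) x : `|col' j x| <= enorm x.
Proof.
apply: norm_le_coord (enorm_ge0 x) _ => i; rewrite mxE.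
exact: coord_le_enorm.
Qed.

Lemma enorm_le_col' (j : 'I_m.+1) x : enorm x <= `|x ord0 j| + m%:R * `|col' j x|.
Proof.
apply: le_trans (enorm_le_sum x) _; rewrite (bigD1_ord j)//= lerD2l.
rewrite (@le_trans _ _ (\sum_(i < m) `|col' j x|))//.
  by apply: ler_sum => i _; have := coord_le_norm (col' j x) i; rewrite mxE.
by rewrite sumr_const card_ord mulr_natl.
Qed.

(* Near [y0], [A] contains almost half of every small ball centred inside it. *)
Definition flat_ball (A : set 'rV[R]_m.+1) (y0 : 'rV[R]_m.+1) (K rho : R) :=
  forall x s, interior A x -> enorm (x - y0) <= rho -> 0 < s -> s <= rho ->
    K * s < 1 -> exists c w, half_cball c (s * (1 - K * s)) w `<=` A `&` cball x s.

(** The covering comes from dropping the [j]-th rotated coordinate, a map with Lipschitz inverse on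
    the graph. For the half-ball, the cutting hyperplane is parallel to the tangent of the graph
    over [x], and the centre is shifted away from the graph by twice the Taylor error, so that a
    segment from [x] to a point of the half-ball cannot meet the graph. Which side of the graph
    belongs to [A] is never decided: a segment leaving [A] must cross its boundary. *)
Lemma C11_chart A y0 : boundary A y0 -> C11_boundary A ->
  exists K rho, [/\ 0 < K, 0 < rho, flat_ball A y0 K rho &
    coverable (boundary A `&` cball y0 rho) m].
Proof.
move=> By0 /(_ y0 By0) [U [Q [j [V [phi [Uy0 [QQ _] oV C11 imE]]]]]].
have QQ' : Q^T *m Q = 1%:M by exact: mulmx1C.
pose pr z := col' j (z *m Q).
have enQ z : enorm (z *m Q) = enorm z by exact: enorm_orthogonal.
have prB y z : `|pr y - pr z| <= enorm (y - z).
  rewrite -enQ (_ : pr y - pr z = col' j ((y - z) *m Q)) ?norm_col'_le//.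
  by rewrite /pr mulmxBl; apply/rowP => i; rewrite !mxE.
have on_graph z : boundary A z -> U z -> V (pr z) /\ (z *m Q) ord0 j = phi (pr z).
  move=> Bz Uz; suff : graph_over j V phi (z *m Q) by [].
  by rewrite -imE; exists z.
have of_graph z : V (pr z) -> (z *m Q) ord0 j = phi (pr z) -> boundary A z.
  move=> Vz zE; have : graph_over j V phi (z *m Q) by split.
  rewrite -imE => -[y [By _] /(congr1 (mulmx^~ Q^T))].
  by rewrite -!mulmxA QQ !mulmx1 => <-.
have [Vu0 _] := on_graph _ By0 (nbhs_singleton Uy0).
have [K [rT [K0 rT0 rT1 T]]] := C11_taylor oV Vu0 C11.
have /nbhs_cballP[rU rU0 rUU] := Uy0.
(* The points used below are within [rho + s <= 2 * rho] of [y0]; they stay in [U] and project into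
   the Taylor neighbourhood. *)
pose rho := Num.min (rU / 2) (rT / 3).
have rho0 : 0 < rho by rewrite lt_min !divr_gt0.
have rhoU z : enorm (z - y0) <= 2 * rho -> U z.
  move=> zy; apply: rUU; rewrite /cball /=; apply: le_trans zy _.
  have : rho <= rU / 2 by rewrite ge_min lexx.
  lra.
have rhoT z : enorm (z - y0) <= 2 * rho -> `|pr z - pr y0| < rT.
  move=> zy; apply: le_lt_trans (prB _ _) _; apply: le_lt_trans zy _.
  have : rho <= rT / 3 by rewrite ge_min lexx orbT.
  lra.
exists (2 * K), rho; split; rewrite ?mulr_gt0//; last first.
  apply: (@coverable_lip _ _ _ (fun z => pr z - pr y0) 1 (K + m%:R)) => //.
  - by rewrite ltr_wpDr.
  - move=> y i [_ yr]; apply: le_trans (coord_le_norm _ _) _.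
    apply: le_trans rT1; apply/ltW/rhoT; apply: (le_trans yr).
    by rewrite ler_pMl// ler1n.
  - have r2 : rho <= 2 * rho by rewrite ler_pMl// ler1n.
    move=> y y' [By yr] [By' y'r].
    have [_ yE] := on_graph _ By (rhoU _ (le_trans yr r2)).
    have [_ y'E] := on_graph _ By' (rhoU _ (le_trans y'r r2)).
    rewrite opprB addrA subrK -enQ; apply: le_trans (enorm_le_col' j _) _.
    rewrite mulmxBl (_ : (y *m Q - y' *m Q) ord0 j =
      (y *m Q) ord0 j - (y' *m Q) ord0 j); last by rewrite !mxE.
    rewrite yE y'E mulrDl.
    rewrite (_ : col' j _ = pr y - pr y'); last by apply/rowP => i; rewrite !mxE.
    rewrite lerD2r.
    by have [] := T _ _ (rhoT _ (le_trans y'r r2)) (rhoT _ (le_trans yr r2)).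
move=> x s Ax xr s0 sr Ks.
have xr2 : enorm (x - y0) <= 2 * rho by apply: (le_trans xr); rewrite ler_pMl// ler1n.
(* Signed height above the graph. The sign [sg] below is such that [sg] times the axis direction
   points from [x] towards the graph. *)
pose gap z := (z *m Q) ord0 j - phi (pr z).
have gx0 : gap x != 0.
  rewrite subr_eq0; apply/eqP => gx; have [_] : boundary A x.
    by apply: of_graph => //; have [] := T _ _ (rhoT _ xr2) (rhoT _ xr2).
  exact.
have [sg [sg1 sgx]] : exists sg : R, sg * sg = 1 /\ sg * gap x < 0.
  have [g|g|/eqP] := ltgtP (gap x) 0; last by rewrite (negbTE gx0).
    by exists 1; rewrite !mul1r.
  by exists (-1); rewrite mulrNN mulN1r oppr_lt0 mulr1.
(* Conormal to the graph over [pr x]: it vanishes on the tangent directions. *)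
pose W : 'cV[R]_m.+1 := \col_k
  oapp (fun i => - 'D_(delta_mx ord0 i) phi (pr x)) 1 (unlift j k).
have WE (v : 'rV[R]_m.+1) : (v *m W) ord0 ord0 =
    v ord0 j - \sum_i v ord0 (lift j i) * 'D_(delta_mx ord0 i) phi (pr x).
  rewrite mxE (bigD1_ord j)//= mxE unlift_none /= mulr1 -sumrN; congr (_ + _).
  by apply: eq_bigr => i _; rewrite mxE liftK /= mulrN.
(* The shift [k] is twice the Taylor error [K * s ^+ 2]; the reduced radius [s - k] keeps the
   shifted ball within [s] of [x]. *)
pose e : 'rV[R]_m.+1 := delta_mx ord0 j *m Q^T; pose k := 2 * K * s ^+ 2.
have eQ : e *m Q = delta_mx ord0 j by rewrite -mulmxA QQ' mulmx1.
have eW : (e *m Q *m W) ord0 ord0 = 1.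
  rewrite eQ WE mxE !eqxx big1 ?subr0// => i _.
  by rewrite mxE (eq_sym (lift _ _)) (negbTE (neq_lift _ _)) andbF mul0r.
have e1 : enorm e = 1 by rewrite -enQ eQ enorm_delta.
have k0 : 0 <= k by rewrite !mulr_ge0 ?exprn_ge0// ltW.
have nsg : `|sg| = 1.
  have : `|sg| * `|sg| = 1 by rewrite -normrM sg1 normr1.
  by have := normr_ge0 sg; nra.
exists (x - (sg * k) *: e), (sg *: (Q *m W)) => z [zc zw].
have zx : enorm (z - x) <= s.
  apply: le_trans (enorm_dist_triangle (x - (sg * k) *: e) _ _) _.
  apply: (le_trans (lerD zc (lexx _))).
  rewrite addrAC subrr add0r enormN enormZ normrM nsg mul1r (ger0_norm k0).
  rewrite (_ : s * _ = s - k); last by rewrite /k; ring.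
  by rewrite e1 mulr1 subrK.
split => //; apply: contrapT => Az.
have [t [t0 t1 Bp]] := segment_boundary (interior_subset Ax) Az.
set p := x + _ in Bp.
have px : p - x = t *: (z - x) by rewrite /p addrAC subrr add0r.
have pxs : enorm (p - x) <= t * s.
  by rewrite px enormZ ger0_norm// ler_wpM2l.
have py : enorm (p - y0) <= 2 * rho.
  apply: le_trans (enorm_dist_triangle x _ _) _; rewrite mulr_natl mulr2n.
  by rewrite lerD// (le_trans pxs)// (le_trans _ sr)// ler_piMl// ltW.
have [_ gp] := on_graph _ Bp (rhoU _ py).
have [_ _] := T _ _ (rhoT _ xr2) (rhoT _ py).
set rem := phi (pr p) - _ - _ => remP.
have {}remP : `|rem| <= K * (t * s) ^+ 2.
  apply: le_trans remP _; rewrite ler_pM2l// lerXn2r ?nnegrE ?mulr_ge0 ?(ltW s0)//.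
  exact: le_trans (prB _ _) pxs.
(* At the crossing point [p] the height vanishes, so the conormal applied to [p - x] is the Taylor
   remainder minus the height of [x]. *)
have lE : t * ((z - x) *m Q *m W) ord0 ord0 = rem - gap x.
  rewrite /gap /rem -gp opprB.
  rewrite (_ : t * _ = ((p - x) *m Q *m W) ord0 ord0); last first.
    by rewrite px -!scalemxAl [RHS]mxE.
  rewrite WE mulmxBl [X in X - _]mxE [X in _ + X - _]mxE.
  rewrite (eq_bigr (fun i => (pr p - pr x) ord0 i *
     'D_(delta_mx ord0 i) phi (pr x))); last by move=> i _; rewrite !mxE.
  by ring.
have lsg : sg * ((z - x) *m Q *m W) ord0 ord0 <= - k.
  move: zw; rewrite /= -scalemxAr mxE opprB addrCA addrC mulmxDl mxE.
  rewrite [X in _ + X](_ : _ = sg * k * (e *m Q *m W) ord0 ord0); last first.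
    by rewrite -scalemxAl mulmxA mxE.
  rewrite eW mulr1 mulmxA mulrDr mulrA sg1 mul1r.
  by lra.
have : sg * (rem - gap x) <= - (t * k).
  by rewrite -lE mulrCA -mulrN ler_wpM2l.
have : - (K * (t * s) ^+ 2) <= sg * rem.
  have : `|sg * rem| <= K * (t * s) ^+ 2 by rewrite normrM nsg mul1r.
  by rewrite ler_norml => /andP[].
(* As [t <= 1], the shift dominates the remainder; the strict inequality [sg * gap x < 0] then gives
   the contradiction. *)
have : K * (t * s) ^+ 2 <= t * k.
  rewrite /k [leRHS](_ : _ = K * (t * s) ^+ 2 + K * s ^+ 2 * (t * (2 - t))); last by ring.
  by rewrite lerDl !mulr_ge0 ?exprn_ge0 ?(ltW K0) ?(ltW s0)// subr_ge0; lra.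
by lra.
Qed.

End chart.

Section regular_boundary.
Context {R : realType} {m : nat}.
Implicit Types (A : set 'rV[R]_m.+1) (x y z : 'rV[R]_m.+1).

(** All that the later sections use of the smoothness of the boundary, in a form shared by [C11]
    sets and intervals. *)
Definition regular_boundary A :=
  coverable (boundary A) m /\
  forall y0, boundary A y0 -> exists K rho, [/\ 0 < K, 0 < rho & flat_ball A y0 K rho].

Lemma rV_compact_closed A : compact A -> closed A.
Proof. by apply: compact_closed; exact: norm_hausdorff. Qed.

Lemma closed_boundary A : closed (boundary A).
Proof.
rewrite /boundary setDE; apply: closedI; first exact: closed_closure.
by apply: open_closedC; exact: open_interior.
Qed.

Lemma boundary_sub A : closed A -> boundary A `<=` A.
Proof. by move=> /closure_id AE x [cA _]; rewrite AE. Qed.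

Lemma compact_boundary A : compact A -> compact (boundary A).
Proof.
move=> cA; apply: (subclosed_compact _ cA); first exact: closed_boundary.
exact: boundary_sub (rV_compact_closed cA).
Qed.

Lemma C11_regular A : compact A -> C11_boundary A -> regular_boundary A.
Proof.
move=> cA C11; split=> [|y0 By0].
  apply: coverable_compact; first exact: compact_boundary.
  by move=> x Bx; have [K [rho [_ rho0 _ cov]]] := C11_chart Bx C11; exists rho.
by have [K [rho [? ? ? _]]] := C11_chart By0 C11; exists K, rho.
Qed.

Lemma coverable1 y p : coverable [set y] p.
Proof.
exists 1 => // rho rho0 rho1; exists [:: y].
  split=> [c|x /= ->]; first by rewrite inE => /eqP.
  by exists y; rewrite ?mem_head// subrr enorm0 ltW.
by rewrite mul1r exprn_ege1// invf_ge1.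
Qed.

End regular_boundary.

(** * The one-dimensional case *)

Section interval.
Context {R : realType} (A : set 'rV[R]_1).
Hypothesis A_itv : is_interval [set t : R | A (const_mx t)].
Implicit Types (x y z : 'rV[R]_1).

Lemma itv_between x y z : A x -> A z ->
  x ord0 ord0 <= y ord0 ord0 <= z ord0 ord0 -> A y.
Proof.
have cE (t : 'rV[R]_1) : const_mx (t ord0 ord0) = t :> 'rV[R]_1.
  by apply/rowP => i; rewrite mxE (ord1 i).
move=> Ax Az yxz; rewrite -(cE y).
by apply: (A_itv (x := x ord0 ord0) (y := z ord0 ord0)) => //=; rewrite ?cE.
Qed.

Lemma enorm1 x : enorm x = `|x ord0 ord0|.
Proof. by rewrite /enorm big_ord1 sqrtr_sqr. Qed.

Lemma itv_interior x y z : A x -> A z ->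
  x ord0 ord0 < y ord0 ord0 < z ord0 ord0 -> interior A y.
Proof.
move=> Ax Az /andP[xy yz]; apply/nbhs_cballP.
exists (Num.min (y ord0 ord0 - x ord0 ord0) (z ord0 ord0 - y ord0 ord0)).
  by rewrite lt_min !subr_gt0 xy.
move=> t; rewrite /cball /= enorm1 !mxE le_min !ler_norml => /andP[t1 t2].
by apply: (itv_between Ax Az); lra.
Qed.

(** Of three boundary points the middle one would be interior, so there are at most two. Positive
    volume gives a point [p] of [A] other than [y0], and near [y0] the half-interval facing [p]
    stays in [A]. *)
Lemma itv_regular : compact A -> (0 < lebesgue_rV 1 A)%E -> regular_boundary A.
Proof.
move=> cA A0; have clA := rV_compact_closed cA.
have BA := boundary_sub clA.
split=> [|y0 By0].
  have [[y1 By1]|B0] := pselect (exists y1, boundary A y1); last first.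
    rewrite (_ : boundary A = set0); first exact: coverable0.
    by apply/seteqP; split => // y By; apply: B0; exists y.
  have [[y2 [By2 y12]]|B1] := pselect (exists y2, boundary A y2 /\ y2 <> y1); last first.
    rewrite (_ : boundary A = [set y1]); first exact: coverable1.
    apply/seteqP; split => [y By|y -> //]; apply: contrapT => yy1.
    by apply: B1; exists y.
  rewrite (_ : boundary A = [set y1] `|` [set y2]).
    by apply: coverableU; exact: coverable1.
  apply/seteqP; split => [y By|y [->|->]]//.
  apply: contrapT => /not_orP[/= yy1 yy2].
  have neq (x z : 'rV[R]_1) : x <> z -> x ord0 ord0 != z ord0 ord0.
    by move=> xz; apply/eqP => E; apply: xz; apply/rowP => i; rewrite (ord1 i).
  have mid x w z : boundary A x -> boundary A w -> boundary A z ->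
      x ord0 ord0 < w ord0 ord0 -> w ord0 ord0 < z ord0 ord0 -> False.
    move=> Bx [_ Bw] Bz xw wz; apply: Bw.
    by apply: (itv_interior (BA _ Bx) (BA _ Bz)); rewrite xw.
  have := neq _ _ yy1; have := neq _ _ yy2; have := neq _ _ y12.
  by case: ltgtP => // a _; case: ltgtP => // b _; case: ltgtP => // c _;
    first [exact: (mid y1 y y2)|exact: (mid y1 y2 y)|exact: (mid y y1 y2)
          |exact: (mid y2 y1 y)|exact: (mid y2 y y1)|exact: (mid y y2 y1)].
have [p [Ap py0]] : exists p, A p /\ p ord0 ord0 != y0 ord0 ord0.
  apply: contrapT => noP; move: A0; rewrite lt_neqAle => /andP[/eqP + _]; apply.
  apply/esym/(@coverable_null _ _ _ 0) => //; first exact: measurable_closed_rV.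
  rewrite (_ : A = [set y0]); first exact: coverable1.
  apply/seteqP; split => [x Ax|x ->]; last exact: BA.
  apply: contrapT => xy; apply: noP; exists x; split => //.
  by apply/eqP => E; apply: xy; apply/rowP => i; rewrite (ord1 i).
(* A quarter, so that any [x] within [rho] of [y0] is still [3 * rho] away from [p], more than the
   radius [s <= rho]. *)
pose rho := `|p ord0 ord0 - y0 ord0 ord0| / 4.
have rho0 : 0 < rho by rewrite divr_gt0// normr_gt0 subr_eq0.
exists 1, rho; split => // x s /interior_subset Ax; rewrite enorm1 !mxE => xr s0 sr s1.
(* The sign selects the half of the interval facing [p]. *)
exists x, (const_mx (if p ord0 ord0 < x ord0 ord0 then 1 else -1)) => z [].
rewrite /cball /= enorm1 !mxE big_ord1 !mxE => zs zw.
have {}zs : `|z ord0 ord0 - x ord0 ord0| <= s.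
  by apply: (le_trans zs); rewrite mul1r ler_piMr ?(ltW s0)//; lra.
split; last exact: zs.
have px : 3 * rho <= `|p ord0 ord0 - x ord0 ord0|.
  have := ler_distD (x ord0 ord0) (p ord0 ord0) (y0 ord0 ord0).
  have : `|p ord0 ord0 - y0 ord0 ord0| = 4 * rho by rewrite /rho; field.
  lra.
move: zs; rewrite ler_norml => /andP[zs1 zs2].
case: ltP zw px => [pz|xp] zw.
  rewrite distrC ger0_norm ?subr_ge0 ?(ltW pz)// => px.
  by apply: (itv_between Ap Ax); lra.
rewrite ger0_norm ?subr_ge0// => px.
by apply: (itv_between Ax Ap); lra.
Qed.

End interval.

(** * Mass of balls centred near the boundary *)

Section local_mass.
Context {R : realType} {m : nat}.
Variables (A : set 'rV[R]_m.+1) (f : 'rV[R]_m.+1 -> R).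
Hypothesis f_cont : {within A, continuous f}.
Local Notation theta := (unit_ball_volume R m.+1).

Lemma within_cball x (U : set R) : A x -> nbhs (f x) U ->
  exists2 r, 0 < r & forall z, A z -> cball x r z -> U (f z).
Proof.
move=> Ax Uf; have := @f_cont x U Uf.
rewrite /= /nbhs /= -nbhs_subspace_in// => /nbhs_cballP[r r0 rU].
by exists r => // z Az /rU; exact.
Qed.

(** Near a boundary point the density exceeds any [b < f1], and the ball contains a half-ball of
    radius [s * (1 - K * s)] inside [A]. Compactness of the boundary makes the threshold on [s]
    uniform in [y]. The factor 4 leaves room for the use with [s = (1 - delta) * r] and centres
    within [2 * r] of the boundary. *)
Lemma ball_mass_boundary (nu : probability 'rV[R]_m.+1 R) (f1 a : R) :
  is_density nu f -> compact A -> regular_boundary A ->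
  (forall y, boundary A y -> f1 <= f y) -> a < f1 / 2 ->
  \forall s \near 0^'+, forall y, boundary A y ->
    forall x, interior A x -> enorm (x - y) <= 4 * s ->
    ((a * theta * s ^+ m.+1)%:E <= nu (cball x s))%E.
Proof.
move=> nuf cA [_ flat] ff1 af1.
have th0 := @unit_ball_volume_gt0 R m.+1.
(* A negative [a] can arise as [f1 / 2 - delta], and the bound is then trivial; otherwise [b] below
   is positive. *)
have [a0|a0] := ltP a 0.
  near=> s => y _ x _ _; apply: le_trans (measure_ge0 _ _).
  have s0 : 0 < s by near: s; exact: nbhs_right_gt.
  by rewrite lee_fin mulr_le0_ge0 ?exprn_ge0 ?(ltW s0)// nmulr_rle0// ltW.
have cB := compact_boundary cA; move: cB.
rewrite compact_near_coveringP => /(_ _ 0^'+ (fun s y => forall x, interior A x ->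
  enorm (x - y) <= 4 * s -> ((a * theta * s ^+ m.+1)%:E <= nu (cball x s))%E)).
apply=> y0 By0; have Ay0 := boundary_sub (rV_compact_closed cA) By0.
pose b := (f1 + 2 * a) / 2.
have [ab bf1] : 2 * a < b /\ b < f1 by rewrite /b; split; lra.
have [r r0 rb] : exists2 r, 0 < r & forall z, A z -> cball y0 r z -> b < f z.
  apply: (within_cball (U := [set t | b < t])) => //.
  by apply: open_nbhs_nbhs; split; [exact: open_gt|exact: lt_le_trans (ff1 _ By0)].
have [K [rho [K0 rho0 flatK]]] := flat _ By0.
(* [x] will be within [5 * e] of [y0] and the half-ball within [6 * e], so both neighbourhoods
   apply. *)
pose e := Num.min rho r / 8.
have mr0 : 0 < Num.min rho r by rewrite lt_min rho0.
have e0 : 0 < e by rewrite divr_gt0.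
have [erho er] : 8 * e <= rho /\ 8 * e <= r.
  by rewrite /e mulrC divfK// !ge_min !lexx orbT.
have small : \forall s \near 0^'+, a < b / 2 * (1 - K * s) ^+ m.+1.
  have C : (b / 2 * (1 - K * s) ^+ m.+1) @[s --> 0^'+] --> b / 2 * (1 - K * 0) ^+ m.+1.
    apply: cvg_at_right_filter; apply: cvgM; first exact: cvg_cst.
    apply: (@cvg_comp _ _ _ (fun s => 1 - K * s) (fun t => t ^+ m.+1) _
      (nbhs (1 - K * 0))); last exact: exprn_continuous.
    apply: cvgB; [exact: cvg_cst|apply: cvgM; [exact: cvg_cst|exact: cvg_id]].
  move: C; rewrite mulr0 subr0 expr1n mulr1 => /cvgr_gt; apply; lra.
exists (cball y0 e, [set s | [/\ 0 < s, s < e, K * s < 1 &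
    a < b / 2 * (1 - K * s) ^+ m.+1]]).
  split => /=; first exact: nbhs_cball.
  near=> s; split; [by near: s; exact: nbhs_right_gt|by near: s; exact: nbhs_right_lt| |by near: s].
  rewrite mulrC -ltr_pdivlMr// mul1r; near: s; apply: nbhs_right_lt.
  by rewrite invr_gt0.
move=> [y s] [/= ye [s0 se Ks sb]] x Ax xy.
have xy0 : enorm (x - y0) <= 5 * e.
  apply: le_trans (enorm_dist_triangle y _ _) _; move: ye; rewrite /cball /=; lra.
have [||c [w cw]] := flatK x s Ax _ s0 _ Ks; [lra|lra|].
have r'0 : 0 < s * (1 - K * s) by rewrite mulr_gt0// subr_gt0.
apply: (@le_trans _ _ (nu (half_cball c (s * (1 - K * s)) w))); last first.
  apply: le_measure; rewrite ?inE; [exact: measurable_half_cball|exact: measurable_cball|].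
  by move=> z /cw[].
apply: (@le_trans _ _ (b%:E * lebesgue_rV _ (half_cball c (s * (1 - K * s)) w))%E).
  apply: (@le_trans _ _ (b%:E * (theta * (s * (1 - K * s)) ^+ m.+1 / 2)%:E)%E).
    rewrite -EFinM lee_fin exprMn.
    rewrite (_ : b * _ = b / 2 * (1 - K * s) ^+ m.+1 * theta * s ^+ m.+1); last by ring.
    by rewrite ler_wpM2r ?exprn_ge0 ?(ltW s0)// ler_wpM2r ?(ltW th0)// ltW.
  by rewrite lee_wpmul2l ?lee_fin ?lebesgue_half_cball//; lra.
apply: (density_ge nuf) => //; [exact: measurable_half_cball|lra|].
move=> z /cw[Az zx]; apply/ltW/rb => //; rewrite /cball /=.
by apply: le_trans (enorm_dist_triangle x _ _) _; move: zx; rewrite /cball /=; lra.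
Unshelve. all: by end_near. Qed.

End local_mass.

(** * Poisson samples *)

Section poisson_series.
Context {R : realType}.

Lemma exp_series (x : R) : 0 <= x ->
  (\sum_(0 <= i <oo) (x ^+ i / i`!%:R)%:E)%E = (expR x)%:E.
Proof.
move=> x0; rewrite expRE -EFin_lim; last first.
  rewrite /pseries/=; under eq_fun do rewrite mulrC.
  exact: is_cvg_series_exp_coeff.
apply/congr_lim/funext => n/=; rewrite /pseries/= /series/= -sumEFin//.
by under eq_bigr do rewrite mulrC.
Qed.

(** Terms with [m < k] vanish with the falling factorial; for [m = i + k] it cancels against the
    factorial of [m] and leaves an exponential series in [n * q]. *)
Lemma poisson_ffact_series (n a q : R) (k : nat) : 0 < n -> 0 <= a -> 0 <= q ->
  (\sum_(0 <= m <oo) (poisson_pmf n m * ((m ^_ k)%:R * (a * q ^+ (m - k))))%:E)%E =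
  (n ^+ k * a * expR (- n) * expR (n * q))%:E.
Proof.
move=> n0 a0 q0; 
pose f m := (poisson_pmf n m * ((m ^_ k)%:R * (a * q ^+ (m - k))))%:E.
rewrite -[LHS]/(\sum_(0 <= m <oo) f m)%E.
have f0 m : (0 <= f m)%E.
  by rewrite lee_fin !mulr_ge0 ?poisson_pmf_ge0// exprn_ge0.
rewrite (nneseries_split 0 k)// big1_seq ?add0e; last first.
  by move=> i; rewrite mem_index_iota add0n => /andP[_ ik]; rewrite /f ffact_small// mul0r mulr0.
rewrite add0n -nneseries_addn//.
have E i : f (i + k)%N = ((n ^+ k * a * expR (- n))%:E * ((n * q) ^+ i / i`!%:R)%:E)%E.
  rewrite /f /poisson_pmf n0 -EFinM addnK; congr _%:E.
  have -> : (i + k)`!%:R = (((i + k) ^_ k)%:R * i`!%:R : R).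
    by rewrite -natrM -(ffact_fact (leq_addl i k)) addnK.
  have i0 : i`!%:R != 0 :> R by rewrite pnatr_eq0 -lt0n fact_gt0.
  have ik0 : ((i + k) ^_ k)%:R != 0 :> R.
    by rewrite pnatr_eq0 -lt0n ffact_gt0 leq_addl.
  by rewrite exprD exprMn; field; rewrite i0.
under eq_eseriesr do rewrite E.
rewrite nneseriesZl; last first.
  by move=> i _; rewrite lee_fin divr_ge0// exprn_ge0// mulr_ge0// ltW.
by rewrite exp_series// mulr_ge0// ltW.
Qed.

End poisson_series.

Section pattern.
Context {R : realType} {d : nat} {disp : measure_display}.
Context {Omega : measurableType disp} (P : probability Omega R).
Variables (X : nat -> {RV P >-> 'rV[R]_d}) (nu : probability 'rV[R]_d R).
Hypothesis X_law : forall i B, measurable B -> distribution P (X i) B = nu B.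
Hypothesis X_indep : mutually_independent P X.
Variables (n : R) (N : {RV P >-> nat}).
Hypothesis n_gt0 : 0 < n.
Hypothesis N_law : forall j : nat, P (N @^-1` [set j]) = (poisson_pmf n j)%:E.
Hypothesis N_indep : independent_of_sequence P N X.

Section cells.
Variables (k : nat) (C : 'I_k -> set 'rV[R]_d) (B : set 'rV[R]_d).
Hypothesis mC : forall l, measurable (C l).
Hypothesis mB : measurable B.
Hypothesis CB : forall l, C l `<=` B.
Hypothesis C_disj : forall l l' x, C l x -> C l' x -> l = l'.

(* The cell in which the [j]-th point must lie when [f l] is the index of the
   point filling [C l]. *)
Definition slot m (f : {ffun 'I_k -> 'I_m}) (j : nat) : set 'rV[R]_d :=
  if [pick l | f l == j :> nat] is Some l then C l else ~` B.

Definition slots m (f : {ffun 'I_k -> 'I_m}) : set Omega :=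
  \bigcap_(j in [set` [fset j in iota 0 m]%fset]) X j @^-1` slot f j.

Definition fillings m : seq {ffun 'I_k -> 'I_m} :=
  [seq f : {ffun 'I_k -> 'I_m} <- enum {: {ffun 'I_k -> 'I_m}} | injectiveb f].

(** For disjoint cells inside [B]: each cell receives exactly one sample point, and the rest of [B]
    none. Listing the sample size and the indices filling the cells makes this a disjoint union of
    events to which independence applies directly. *)
Definition pattern : set Omega :=
  \bigcup_m (N @^-1` [set m] `&` \bigcup_(f in [set` fillings m]) slots f).

Lemma measurable_slot m (f : {ffun 'I_k -> 'I_m}) j : measurable (slot f j).
Proof. by rewrite /slot; case: pickP => // _; exact: measurableC. Qed.

Lemma slot_filled m (f : {ffun 'I_k -> 'I_m}) l : injective f -> slot f (f l) = C l.
Proof.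
move=> If; rewrite /slot; case: pickP => [l' /eqP/val_inj/If -> //|/(_ l)].
by rewrite eqxx.
Qed.

Lemma slot_empty m (f : {ffun 'I_k -> 'I_m}) (j : 'I_m) : j \notin codom f ->
  slot f j = ~` B.
Proof.
move=> jf; rewrite /slot; case: pickP => // l /eqP/val_inj fl.
by rewrite -fl codom_f in jf.
Qed.

Lemma mem_fillings m f : (f \in fillings m) = injectiveb f.
Proof. by rewrite mem_filter mem_enum andbT. Qed.

Lemma sequence_sigma_slots m (f : {ffun 'I_k -> 'I_m}) :
  sequence_sigma_algebra X (slots f).
Proof.
suff : measurable (slots f : set (g_sigma_algebraType
  (\bigcup_i preimage_set_system setT (X i) measurable))) by [].
apply: fin_bigcap_measurable => [|j _]; first exact: finite_fset.
apply: sub_sigma_algebra; exists j => //; exists (slot f j).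
  exact: measurable_slot.
by rewrite setTI.
Qed.

Lemma sequence_sigma_fillings m :
  sequence_sigma_algebra X (\bigcup_(f in [set` fillings m]) slots f).
Proof.
suff : measurable (\bigcup_(f in [set` fillings m]) slots f : set (g_sigma_algebraType
  (\bigcup_i preimage_set_system setT (X i) measurable))) by [].
by apply: fin_bigcup_measurable => [|f _]; [exact: finite_seq|exact: sequence_sigma_slots].
Qed.

Lemma measurable_slots m (f : {ffun 'I_k -> 'I_m}) : measurable (slots f).
Proof.
apply: fin_bigcap_measurable => [|j _]; first exact: finite_fset.
rewrite -[_ @^-1` _]setTI.
exact: (@measurable_funPT _ _ _ _ (X j) measurableT _ (measurable_slot f j)).
Qed.

Lemma slotsP m (f : {ffun 'I_k -> 'I_m}) w : slots f w <->
  forall j : 'I_m, slot f j (X j w).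
Proof.
split=> [fw j|fw j]; first by apply: fw; rewrite /= !inE mem_iota add0n /=.
by rewrite /= !inE mem_iota add0n /= => jm; exact: (fw (Ordinal jm)).
Qed.

(** On a common outcome the point of index [f l] lies in [C l], hence in [B], so [g] also assigns it
    a cell, and disjoint cells force the same one. *)
Lemma slots_disj m : trivIset [set` fillings m] (@slots m).
Proof.
move=> f g; rewrite /= !mem_fillings => /injectiveP If /injectiveP Ig [w [/slotsP fw /slotsP gw]].
apply/ffunP => l; have := fw (f l); rewrite slot_filled// => Cl.
have := gw (f l).
case: (boolP (f l \in codom g)) => [/codomP[l' E]|]; last first.
  by move/slot_empty -> => /(_ (CB Cl)).
by rewrite E slot_filled// -E => Cl'; rewrite E (C_disj Cl Cl').
Qed.

Lemma prob_slots m (f : {ffun 'I_k -> 'I_m}) : injective f ->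
  P (slots f) = (\prod_l fine (nu (C l)) * (1 - fine (nu B)) ^+ (m - k))%:E.
Proof.
move=> If; rewrite /slots X_indep; last exact: measurable_slot.
rewrite (perm_big (iota 0 m)); last first.
  by apply: uniq_perm => [||j]; rewrite ?fset_uniq ?iota_uniq// !inE.
rewrite -{1}[m]subn0 -/(index_iota 0 m) big_mkord.
have fnu D : measurable D -> nu D = (fine (nu D))%:E by move=> mD; rewrite fineK// fin_num_measure.
rewrite (eq_bigr (fun j : 'I_m => (fine (nu (slot f j)))%:E)); last first.
  by move=> j _; rewrite -fnu; [exact: (X_law j (measurable_slot f j))|exact: measurable_slot].
rewrite prodEFin; congr _%:E; rewrite (bigID [in codom f])/=; congr (_ * _).
  rewrite (eq_bigl [in [set f l | l : 'I_k]%SET]); last first.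
    by move=> j; apply/codomP/imsetP => [[l ->]|[l _ ->]]; exists l.
  rewrite big_imset/=; last by move=> l l' _ _; exact: If.
  by apply: eq_bigr => l _; rewrite slot_filled.
rewrite (eq_bigr (fun=> 1 - fine (nu B))); last first.
  move=> j jf; rewrite (slot_empty jf) probability_setC// fnu//.
rewrite prodr_const; congr (_ ^+ _).
have := cardC (mem (codom f)); rewrite (card_codom If) !card_ord => E.
have km : (k <= m)%N by rewrite -[m in (_ <= m)%N]E leq_addr.
have -> : (m - k = #|[predC mem (codom f)]|)%N by apply: (@addnI k); rewrite E subnKC.
exact: eq_card.
Qed.

Lemma measurable_pattern : measurable pattern.
Proof.
apply: bigcupT_measurable => m; apply: measurableI.
  by rewrite -[_ @^-1` _]setTI; exact: measurable_funPT.
by apply: fin_bigcup_measurable => [|f _]; [exact: finite_seq|exact: measurable_slots].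
Qed.

(** Given [m] points there are [m ^_ k] injective assignments of equal probability; averaging over
    the Poisson size sums the series. The value is that of independent Poisson counts in the cells
    and in the rest of [B]. *)
Lemma prob_pattern : P pattern =
  (\prod_l (n * fine (nu (C l))) * expR (- (n * fine (nu B))))%:E.
Proof.
have nuB1 : 0 <= 1 - fine (nu B).
  by rewrite subr_ge0 -lee_fin fineK ?fin_num_measure// probability_le1.
have p0 : 0 <= \prod_l fine (nu (C l)) by apply: prodr_ge0 => l _; exact: fine_ge0.
pose F m := N @^-1` [set m] `&` \bigcup_(f in [set` fillings m]) slots f.
have mF m : measurable (F m).
  apply: measurableI; first by rewrite -[_ @^-1` _]setTI; exact: measurable_funPT.
  by apply: fin_bigcup_measurable => [|f _]; [exact: finite_seq|exact: measurable_slots].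
have PF m : P (F m) = (poisson_pmf n m * ((m ^_ k)%:R *
    (\prod_l fine (nu (C l)) * (1 - fine (nu B)) ^+ (m - k))))%:E.
  rewrite N_indep; last exact: sequence_sigma_fillings.
  rewrite N_law measure_fin_bigcup; last 3 first.
  - exact: finite_seq.
  - exact: slots_disj.
  - by move=> f _; exact: measurable_slots.
  rewrite -fsbig_seq; last by rewrite filter_uniq// enum_uniq.
  rewrite /fillings big_filter.
  rewrite (eq_bigr (fun=> (\prod_l fine (nu (C l)) * (1 - fine (nu B)) ^+ (m - k))%:E)); last first.
    by move=> f /injectiveP If; exact: prob_slots.
  rewrite sumEFin -EFinM big_enum_cond /= sumr_const.
  congr _%:E; congr (_ * _); rewrite -[LHS]mulr_natl; congr (_%:R * _).
  rewrite -[X in X ^_ _]card_ord -[X in _ ^_ X]card_ord -card_inj_ffuns.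
  by apply: eq_card => f; rewrite inE.
have -> : pattern = \bigcup_m F m by [].
rewrite measure_bigcup//; last first.
  by move=> i j _ _ [w [[/= <- _] [/= <- _]]].
rewrite (eq_eseriesl (Q := xpredT)); last by move=> m; rewrite in_setT.
rewrite (eq_eseriesr (fun m _ => PF m)).
rewrite poisson_ffact_series//; congr _%:E.
rewrite big_split /= prodr_const card_ord -!mulrA; congr (_ * (_ * _)).
by rewrite -expRD; congr expR; ring.
Qed.

End cells.

(** Void probabilities are thus the case [k = 0] of the pattern formula. *)
Lemma pattern0E (B : set 'rV[R]_d) (C : 'I_0 -> set 'rV[R]_d) :
  pattern C B = [set w | forall j, (j < N w)%N -> ~ B (X j w)].
Proof.
apply/seteqP; split => [w [m _ [/= Nm [f _ /slotsP fw]]] j|w /= Bw].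
  by rewrite Nm => jm; have := fw (Ordinal jm); rewrite slot_empty//; apply/codomP => -[[]].
have If : injectiveb [ffun l : 'I_0 => match l with Ordinal _ h => False_rect 'I_(N w) (notF h) end].
  by apply/injectiveP => -[].
exists (N w) => //; split => //; eexists; first by rewrite /= mem_fillings; exact: If.
apply/slotsP => j; rewrite slot_empty; first exact: Bw.
by apply/codomP => -[[]].
Qed.

Lemma measurable_void (B : set 'rV[R]_d) : measurable B ->
  measurable [set w | forall j, (j < N w)%N -> ~ B (X j w)].
Proof. by move=> mB; rewrite -(@pattern0E B (fun=> set0)); exact: measurable_pattern. Qed.

Lemma prob_void (B : set 'rV[R]_d) : measurable B ->
  P [set w | forall j, (j < N w)%N -> ~ B (X j w)] = (expR (- (n * fine (nu B))))%:E.
Proof.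
move=> mB; rewrite -(@pattern0E B (fun=> set0)) prob_pattern//.
- by rewrite big_ord0 mul1r.
- by move=> l x [].
Qed.

End pattern.

(** * Clusters of a finite set *)

Section clusters.
Context {R : realType} {d : nat}.
Implicit Types (S : {fset 'rV[R]_d}) (r delta eta : R) (s G : seq 'rV[R]_d).

Lemma geometric_graph_sym r S : symmetric (@geometric_graph R d S r).
Proof. by move=> x y; rewrite /geometric_graph /= eq_sym enormB. Qed.

Lemma connect_near r S (x y : S) : enorm (val x - val y) <= r ->
  connect (geometric_graph r) x y.
Proof.
have [->|xy] := eqVneq x y; first by rewrite connect0.
by move=> xyr; apply: connect1; rewrite /geometric_graph /= xy.
Qed.

Lemma componentsP r S (K : {set S}) : K \in components S r ->
  exists2 x, x \in K & K = [set y | connect (geometric_graph r) x y]%SET.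
Proof.
move=> /imsetP[x _ ->]; exists x; first by rewrite !inE connect0.
by apply/setP => y; rewrite !inE.
Qed.

Lemma component_in r S (x : S) :
  [set y | connect (geometric_graph r) x y]%SET \in components S r.
Proof. by apply/imsetP; exists x => //; apply/setP => y; rewrite !inE. Qed.

Lemma component_eq r S (x y : S) : connect (geometric_graph r) x y ->
  [set z | connect (geometric_graph r) x z]%SET =
  [set z | connect (geometric_graph r) y z]%SET.
Proof.
move=> xy; apply/setP => z; rewrite !inE.
exact: (same_connect (sym_connect_sym (@geometric_graph_sym r S)) xy).
Qed.

Lemma count_card (T : Type) (x0 : T) (a : pred T) (t : seq T) :
  count a t = #|[set i : 'I_(size t) | a (nth x0 t i)]%SET|.
Proof.
by rewrite -sum1_count (big_nth x0) big_mkord -sum1_card; apply: eq_bigl => i; rewrite inE.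
Qed.

(** [U] may reach outside [B], since it stands for a whole component; its exact cardinality allows
    its points to be indexed by ['I_k]. *)
Definition sparse (k : nat) S (B : set 'rV[R]_d) :=
  exists2 U : {set S}, #|U| = k & forall p : S, B (val p) -> p \in U.

(** Attach to each component a centre whose [delta * r]-ball contains one of its vertices. Two
    points of such a ball are joined, as [2 * delta <= 1], so the attachment is injective; a point
    within [(1 - delta) * r] of the centre is joined to that vertex, so the component contains
    it. *)
Lemma nb_components_le k r delta S s : 0 <= r -> 2 * delta <= 1 ->
  (forall p : S, exists2 c, c \in s & cball c (delta * r) (val p)) ->
  (nb_components k r S <= count (fun c => `[< sparse k S (cball c ((1 - delta) * r)) >]) s)%N.
Proof.
move=> r0 d1 Ss; rewrite (count_card 0).
have Hidx (K : {set S}) : exists i : nat, K \in components S r -> (i < size s)%N /\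
    exists2 p, p \in K & cball (nth 0 s i) (delta * r) (val p).
  have [/componentsP[x xK _]|] := boolP (K \in components S r); last by exists 0%N.
  have [c cs xc] := Ss x; exists (index c s) => _; rewrite index_mem; split => //.
  by exists x => //; rewrite nth_index.
have [idx idxP] := choice Hidx.
have [s0|s0] := posnP (size s).
  rewrite /nb_components (_ : [set _ | _]%SET = finset.set0) ?cards0//.
  apply/setP => K; rewrite !inE; apply/negP => /andP[/idxP[+ _] _].
  by rewrite s0.
pose g K : 'I_(size s) := insubd (Ordinal s0) (idx K).
have gE K : K \in components S r -> g K = idx K :> nat.
  by move=> /idxP[ilt _]; rewrite val_insubd ilt.
have dr (p q : S) a b c : cball c a (val p) -> cball c b (val q) -> a + b <= r ->
    connect (geometric_graph r) p q.
  move=> pc qc ab; apply: connect_near; apply: le_trans ab.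
  by apply: le_trans (enorm_dist_triangle c _ _) _; rewrite lerD// enormB.
rewrite /nb_components -(card_in_imset (f := g)); last first.
  move=> K K'; rewrite !inE => /andP[cK _] /andP[cK' _] /(congr1 val) /=.
  rewrite !gE// => E; have [_ [p pK pc]] := idxP _ cK; have [_ [q qK qc]] := idxP _ cK'.
  have [x _ KE] := componentsP cK; have [y _ K'E] := componentsP cK'.
  move: pK qK; rewrite KE K'E !inE => /component_eq -> /component_eq ->.
  apply: component_eq; rewrite -E in qc; apply: dr pc qc _.
  by rewrite -mulrDl -mulr2n -mulr_natl ler_piMl.
apply/subset_leq_card/fintype.subsetP => i /imsetP[K].
rewrite !inE => /andP[cK /eqP Kk] ->; exists K => // q qc.
have [_ [p pK pc]] := idxP _ cK; have [x _ KE] := componentsP cK.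
move: pK; rewrite KE !inE => /connect_trans; apply.
move: qc; rewrite gE// => qc; apply: dr pc qc _.
by rewrite -mulrDl addrCA subrr addr0 mul1r.
Qed.

Definition hole k r delta eta G (J : {ffun 'I_k -> 'I_(size G)}) (c : 'rV[R]_d) :=
  cball c ((1 - delta) * r) `\`
  \bigcup_(l in @setT 'I_k) cball (c + r *: nth 0 G (J l)) (eta * r).

(** In coordinates centred at [c] and divided by [r], rounding the points of [U] in the ball to the
    net puts every point of the ball into a removed sub-ball. *)
Lemma sparse_hole k r delta eta G S c : 0 < r -> 0 <= delta ->
  (forall x, cball 0 1 x -> exists2 g, g \in G & enorm (x - g) <= eta) ->
  sparse k S (cball c ((1 - delta) * r)) ->
  exists J : {ffun 'I_k -> 'I_(size G)}, forall p : S, ~ hole r delta eta J c (val p).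
Proof.
move=> r0 d0 netG [U Uk SU].
have G0 : (0 < size G)%N.
  have [g] := netG 0 (cball_center _ ler01).
  by case: G {netG}.
pose u (l : 'I_k) : S := enum_val (cast_ord (esym Uk) l).
have near (l : 'I_k) : exists i : 'I_(size G), cball c ((1 - delta) * r) (val (u l)) ->
    cball (c + r *: nth 0 G i) (eta * r) (val (u l)).
  (* Points of [U] outside the ball get an arbitrary index, available since [G] is nonempty. *)
  have [uc|] := pselect (cball c ((1 - delta) * r) (val (u l))); last by exists (Ordinal G0).
  have [g gG ug] : exists2 g, g \in G & enorm (r^-1 *: (val (u l) - c) - g) <= eta.
    apply: netG; rewrite /cball /= subr0 enormZ gtr0_norm ?invr_gt0//.
    rewrite mulrC ler_pdivrMr// mul1r; apply: (le_trans uc).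
    by rewrite ler_piMl ?(ltW r0)//; lra.
  move: gG; rewrite -index_mem => gG; exists (Ordinal gG) => _ /=.
  rewrite nth_index -?index_mem// /cball /= (_ : _ - _ = r *: (r^-1 *: (val (u l) - c) - g)).
    by rewrite enormZ gtr0_norm// mulrC ler_wpM2r// ltW.
  by rewrite scalerBr scalerA mulfV ?gt_eqF// scale1r opprD addrA.
have [J JP] := choice near.
exists [ffun l => J l] => p [pc]; apply.
have pU := SU p pc; exists (cast_ord Uk (enum_rank_in pU p)) => //.
rewrite ffunE; have := JP (cast_ord Uk (enum_rank_in pU p)).
by rewrite /u cast_ordK enum_rankK_in//; apply.
Qed.

Definition cluster_at k (a b : R) S (c : 'rV[R]_d) :=
  exists x : 'I_k -> S, [/\ injective x, (forall l, cball c a (val (x l))) &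
    forall p : S, cball c b (val p) -> exists l, p = x l].

(** The [k] points near [c a] are pairwise joined, as [2 * delta <= 1], and an edge from one of them
    ends within [(1 + delta) * r] of [c a], hence at another of them: they form a component. Centres
    [2 * r] apart give different ones. *)
Lemma nb_components_ge (I : finType) k r delta S (c : I -> 'rV[R]_d) :
  (0 < k)%N -> 0 < r -> 2 * delta <= 1 ->
  (forall a b, a != b -> 2 * r <= enorm (c a - c b)) ->
  (#|[set a | `[< cluster_at k (delta * r) ((1 + delta) * r) S (c a) >]]%SET|
    <= nb_components k r S)%N.
Proof.
move=> k0 r0 d1 sep; set good := (X in (#|X| <= _)%N).
pose l0 := Ordinal k0.
have Hx (a : I) : exists K : {set S}, a \in good ->
    [/\ K \in components S r, #|K| = k & forall p, p \in K -> cball (c a) (delta * r) (val p)].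
  have [|ga] := boolP (a \in good); last by exists finset.set0.
  rewrite inE => /asboolP[x [Ix xa xP]].
  have KE : [set x l | l : 'I_k]%SET = [set y | connect (geometric_graph r) (x l0) y]%SET.
    apply/setP => y; rewrite [RHS]inE; apply/imsetP/idP => [[l _ ->]|].
      apply: connect_near; apply: le_trans (enorm_dist_triangle (c a) _ _) _.
      apply: (@le_trans _ _ (delta * r + delta * r)).
        by rewrite lerD//; [exact: xa|rewrite enormB; exact: xa].
      by rewrite -mulrDl -mulr2n -mulr_natl ler_piMl// ltW.
    move=> /connectP[p + ->]; elim: p (l0) => [l _|z p IH l] /=; first by exists l.
    rewrite /geometric_graph /= => /andP[/andP[_ xz] pz].
    have [l' zl'] : exists l', z = x l'.
      apply: xP; rewrite /cball /=; apply: le_trans (enorm_dist_triangle (val (x l)) _ _) _.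
      by rewrite enormB mulrDl mul1r lerD//; exact: xa.
    by move: pz; rewrite zl' => /IH.
  exists [set x l | l : 'I_k]%SET => _; split.
  - by rewrite KE component_in.
  - by rewrite card_imset// card_ord.
  - by move=> p /imsetP[l _ ->]; exact: xa.
have [K KP] := choice Hx.
rewrite -(card_in_imset (f := K)); last first.
  move=> a b /KP[_ Kk aP] /KP[_ _ bP] E; apply: contrapT => /eqP /sep.
  have [p pK] : exists p, p \in K a by apply/card_gt0P; rewrite Kk.
  have pa := aP _ pK; move: pK; rewrite E => /bP pb.
  apply/negP; rewrite -ltNge.
  apply: le_lt_trans (enorm_dist_triangle (val p) _ _) _.
  apply: (@le_lt_trans _ _ (delta * r + delta * r)).
    by rewrite lerD//; rewrite enormB; exact: pa.
  by rewrite -mulrDl -mulr2n -mulr_natl ltr_pM2r//; lra.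
apply/subset_leq_card/fintype.subsetP => L /imsetP[a /KP[cK Kk _] ->].
by rewrite inE cK Kk eqxx.
Qed.

End clusters.

(** * Bounds on the expected number of clusters *)

Section expectation_bounds.
Context {R : realType} {disp : measure_display} {Omega : measurableType disp}.
Variable P : probability Omega R.
Local Open Scope ereal_scope.

(* No measurability is needed: the integral of a nonnegative function is a
   supremum over simple functions below it. *)
Lemma le_integral_nonmeasurable (g h : Omega -> \bar R) :
  (forall w, 0 <= g w) -> (forall w, g w <= h w) ->
  \int[P]_w g w <= \int[P]_w h w.
Proof.
move=> g0 gh; rewrite !ge0_integralTE//; last first.
  by move=> w; exact: le_trans (g0 w) (gh w).
apply: ge_ereal_sup => _ [u ug <-]; apply: ereal_sup_ubound; exists u => // w.
exact: le_trans (ug w) (gh w).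
Qed.

Variables (I : Type) (s : seq I) (E : I -> set Omega).
Hypothesis mE : forall i, measurable (E i).

Lemma integral_sum_indic :
  \int[P]_w (\sum_(i <- s) (\1_(E i) w)%:E) = \sum_(i <- s) P (E i).
Proof.
rewrite ge0_integral_sum//.
- by apply: eq_bigr => i _; rewrite integral_indic// setIT.
- by move=> i; apply/measurable_EFinP; exact: measurable_indic.
Qed.

(** Adding [+oo] on the null set [N] leaves the integral of the bound unchanged and makes the
    comparison pointwise, as [le_integral_nonmeasurable] requires. *)
Lemma expectation_le (g : Omega -> R) (N : set Omega) : measurable N -> P N = 0 ->
  (forall w, 0 <= g w)%R ->
  (forall w, ~ N w -> g w <= \sum_(i <- s) \1_(E i) w)%R ->
  'E_P[g] <= \sum_(i <- s) P (E i).
Proof.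
move=> mN N0 g0 gE; rewrite unlock -integral_sum_indic.
have sE0 w : 0 <= \sum_(i <- s) (\1_(E i) w)%:E :> \bar R.
  by apply: sume_ge0 => i _; rewrite lee_fin.
have msE : measurable_fun setT (fun w => \sum_(i <- s) (\1_(E i) w)%:E : \bar R).
  by apply: emeasurable_sum => i; apply/measurable_EFinP; exact: measurable_indic.
have mI : measurable_fun setT ((cst +oo : Omega -> \bar R) \_ N).
  by apply/(measurable_restrictT _ _).1 => //; exact: measurable_cst.
have I0 w : 0 <= ((cst +oo : Omega -> \bar R) \_ N) w.
  by rewrite patchE; case: ifP => _ /=; rewrite ?leey.
rewrite -[leRHS]adde0.
rewrite [X in _ <= _ + X](_ : 0 = \int[P]_w ((cst +oo : Omega -> \bar R) \_ N) w); last first.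
  transitivity (+oo * P N); first by rewrite N0 mule0.
  by rewrite -integral_mkcond integral_cst.
rewrite -ge0_integralD//.
apply: le_integral_nonmeasurable => w; first by rewrite lee_fin.
rewrite patchE; case: ifPn => [_|].
  by rewrite addey ?leey//; case: (bigop _ _ _) (sE0 w).
rewrite notin_setE => /gE gw.
by rewrite adde0 sumEFin lee_fin.
Qed.

Lemma expectation_ge (g : Omega -> R) :
  (forall w, \sum_(i <- s) \1_(E i) w <= g w)%R ->
  \sum_(i <- s) P (E i) <= 'E_P[g].
Proof.
move=> gE; rewrite -integral_sum_indic expectation.unlock.
apply: le_integral_nonmeasurable => w; rewrite sumEFin lee_fin//.
by apply: sumr_ge0 => i _.
Qed.

End expectation_bounds.

(** * Nets of the boundary layer *)

Section layers.
Context {R : realType} {m : nat}.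
Implicit Types (A : set 'rV[R]_m.+1).

Lemma unit_ball_net (eta : R) : 0 < eta -> eta <= 1 ->
  exists G : seq 'rV[R]_m.+1,
    forall x, cball 0 1 x -> exists2 g, g \in G & enorm (x - g) <= eta.
Proof.
move=> e0 e1; have [C _ HC] : coverable (cball (0 : 'rV[R]_m.+1) 1) m.+1.
  by apply: (coverable_bounded ltr01).
by have [G [_ HG] _] := HC _ e0 e1; exists G.
Qed.

(** [2 * r] adds the distance from a centre whose [r]-ball leaves [A] to the boundary, at most [r],
    and that from [x] to this centre, at most [delta * r]. *)
Definition layer A (r : R) : set 'rV[R]_m.+1 :=
  [set x | interior A x /\ exists2 y, boundary A y & enorm (x - y) <= 2 * r].

(** Balls of radius [3 * r] around an [r]-net of the boundary cover the layer; each is filled with a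
    scaled net of the unit ball. The scale [delta / 6] becomes [delta * r / 2], doubled when the
    centres are moved into the layer. *)
Lemma layer_net A (delta : R) : coverable (boundary A) m -> 0 < delta -> delta <= 1 ->
  exists2 C, 0 < C & forall r, 0 < r -> r <= 1 ->
    exists2 s, net (layer A r) (delta * r) s & (size s)%:R <= C * r^-1 ^+ m.
Proof.
move=> [C C0 HC] d0 d1.
have [G HG] := @unit_ball_net (delta / 6) ltac:(rewrite divr_gt0//) ltac:(lra).
exists (C * ((size G)%:R + 1)); first by rewrite mulr_gt0// ltr_wpDl.
move=> r r0 r1; have [s [_ sB] sC] := HC r r0 r1.
pose t := [seq c + (3 * r) *: g | c <- s, g <- G].
have r30 : 0 < 3 * r by rewrite mulr_gt0.
have [x [_ [y By xy]]|s' s'L s'C] := @net_recenter _ _ (layer A r) (delta / 2 * r) t.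
  have [c cs yc] := sB y By.
  have xc : enorm (x - c) <= 3 * r.
    by apply: le_trans (enorm_dist_triangle y _ _) _; lra.
  have [|g gG xg] := HG ((3 * r)^-1 *: (x - c)).
    rewrite /cball /= subr0 enormZ gtr0_norm ?invr_gt0//.
    by rewrite mulrC ler_pdivrMr// mul1r.
  exists (c + (3 * r) *: g); first by apply/allpairsP; exists (c, g).
  rewrite (_ : _ - _ = (3 * r) *: ((3 * r)^-1 *: (x - c) - g)); last first.
    by rewrite scalerBr scalerA mulfV ?gt_eqF// scale1r opprD addrA.
  rewrite enormZ gtr0_norm// (_ : delta / 2 * r = 3 * r * (delta / 6)); last by field.
  by rewrite ler_wpM2l// ltW.
exists s'; first by rewrite (_ : delta * r = delta / 2 * r + delta / 2 * r)//; field.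
apply: (@le_trans _ _ ((size s)%:R * (size G)%:R)).
  by rewrite -natrM ler_nat (leq_trans s'C)// /t size_allpairs.
rewrite mulrAC; apply: ler_pM => //; lra.
Qed.

Lemma at_rightP (Q : set R) : (\forall r \near 0^'+, Q r) ->
  exists2 e : R, 0 < e & forall r, 0 < r -> r < e -> Q r.
Proof.
move=> /nbhs_ballP[e /= e0 eQ]; exists e => // r r0 re.
by apply: eQ => //; rewrite -ball_normE /ball_ /= distrC subr0 gtr0_norm.
Qed.

End layers.

Lemma ler_sum_size (R : realType) (I : eqType) (s : seq I) (g : I -> R) (e : R) :
  (forall i, i \in s -> g i <= e) -> \sum_(i <- s) g i <= (size s)%:R * e.
Proof.
elim: s => [|i s IH] ge; first by rewrite big_nil mul0r.
rewrite big_cons /= -natr1 mulrDl mul1r addrC lerD ?ge ?mem_head//.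
by apply: IH => j js; apply: ge; rewrite inE js orbT.
Qed.

(** * Masses of balls and of holes *)

Section masses.
Context {R : realType} {m : nat}.
Variables (A : set 'rV[R]_m.+1) (nu : probability 'rV[R]_m.+1 R).
Variables (f : 'rV[R]_m.+1 -> R) (f0 : R).
Hypothesis A_compact : compact A.
Hypothesis A_reg : regular_boundary A.
Hypothesis nu_density : is_density nu f.
Hypothesis nu_support : measure_support nu = A.
Hypothesis f_cont : {within A, continuous f}.
Hypothesis f0_gt0 : 0 < f0.
Hypothesis f_ge : forall x, A x -> f0 <= f x.
Local Notation theta := (unit_ball_volume R m.+1).
Local Notation mass B := (fine (nu B)).

Lemma massE B : measurable B -> nu B = (mass B)%:E.
Proof. by move=> mB; rewrite fineK// fin_num_measure. Qed.

Lemma support_compl_null : nu.-negligible (~` A).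
Proof. by rewrite -nu_support; exact: measure_support_compl. Qed.

Lemma measurable_interior_compl : measurable (~` interior A).
Proof. by apply: measurableC; apply: measurable_open_rV; exact: open_interior. Qed.

(** The boundary is coverable with exponent [m < m.+1], hence Lebesgue-null and [nu]-null; the
    complement of [A] is off the support. *)
Lemma interior_compl_null : nu (~` interior A) = 0%E.
Proof.
have cA := rV_compact_closed A_compact.
have mB : measurable (boundary A) by apply: measurable_closed_rV; exact: closed_boundary.
have B0 : nu (boundary A) = 0%E.
  apply: (density_null nu_density) => //.
  by apply: coverable_null (proj1 A_reg) => //.
apply/negligibleP; first exact: measurable_interior_compl.
apply: negligibleS (negligibleU support_compl_null _); last exact/negligibleP/B0.
move=> x iAx; have [Ax|] := pselect (A x); last by left.
by right; split => //; exact: subset_closure.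
Qed.

Lemma density_bounded : exists2 F, 0 <= F & forall x, A x -> f x <= F.
Proof.
have /compact_bounded[M [_ MP]] := continuous_compact f_cont A_compact.
exists (`|M| + 1); first by rewrite addr_ge0.
move=> x Ax; apply: le_trans (ler_norm _) _; apply: MP; last by exists x.
by rewrite (le_lt_trans (ler_norm M))// ltrDl.
Qed.

Lemma mass_le (F r : R) c : 0 < r -> 0 <= F ->
  (forall x, A x -> cball c r x -> f x <= F) -> mass (cball c r) <= F * theta * r ^+ m.+1.
Proof.
move=> r0 F0 fF; have mc := measurable_cball c r.
have := density_le nu_density (measurable_closed_rV (rV_compact_closed A_compact)) mc
  support_compl_null F0 fF.
by rewrite massE// lebesgue_cball// -EFinM lee_fin mulrA.
Qed.

Lemma mass_ge r c : 0 < r -> cball c r `<=` A -> f0 * theta * r ^+ m.+1 <= mass (cball c r).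
Proof.
move=> r0 cA; have mc := measurable_cball c r.
have := density_ge nu_density mc (ltW f0_gt0) (fun x cx => f_ge (cA x cx)).
by rewrite massE// lebesgue_cball// -EFinM lee_fin mulrA.
Qed.

Lemma measurable_hole k r delta eta G (J : {ffun 'I_k -> 'I_(size G)}) (c : 'rV[R]_m.+1) :
  measurable (hole r delta eta J c).
Proof.
apply: measurableD; first exact: measurable_cball.
by apply: fin_bigcup_measurable => // l _; exact: measurable_cball.
Qed.

(** Each removed ball has mass at most [F * theta * (eta * r) ^+ m.+1] wherever its centre lies,
    because [nu] lives on [A]. *)
Lemma mass_hole k r delta eta F G (J : {ffun 'I_k -> 'I_(size G)}) (c : 'rV[R]_m.+1) :
  0 < r -> 0 < eta -> 0 <= F -> (forall x, A x -> f x <= F) ->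
  mass (cball c ((1 - delta) * r)) - k%:R * (F * theta * (eta * r) ^+ m.+1) <=
  mass (hole r delta eta J c).
Proof.
move=> r0 e0 F0 fF; rewrite lerBlDr.
pose b l := cball (c + r *: nth 0 G (J l)) (eta * r).
have mb l : measurable (b l) by exact: measurable_cball.
have mU : measurable (\bigcup_(l in @setT 'I_k) b l) by exact: fin_bigcup_measurable.
have mh := measurable_hole r delta eta J c.
have mc := measurable_cball c ((1 - delta) * r).
have : (nu (cball c ((1 - delta) * r)) <=
    nu (hole r delta eta J c) + \sum_(l < k) nu (b l))%E.
  apply: (@le_trans _ _ (nu (hole r delta eta J c) + nu (\bigcup_(l in @setT 'I_k) b l))%E).
    apply: (le_trans _ (measureU2 _ _ _)) => //.
    rewrite le_measure ?inE//; first exact: measurableU.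
    by move=> x xc; have [?|?] := pselect ((\bigcup_(l in @setT 'I_k) b l) x); [right|left].
  rewrite leeD2l//; apply: measure_le_sum => // x [l _ xl].
  by exists l => //; rewrite mem_index_enum.
rewrite massE// (massE mh) (eq_bigr (fun l => (mass (b l))%:E)); last first.
  by move=> l _; rewrite massE.
rewrite sumEFin -EFinD lee_fin => /le_trans; apply; rewrite lerD2l.
rewrite (@le_trans _ _ (\sum_(l < k) F * theta * (eta * r) ^+ m.+1))//.
  by apply: ler_sum => l _; apply: mass_le => //; [exact: mulr_gt0|move=> x /fF].
by rewrite sumr_const card_ord mulr_natl.
Qed.

End masses.

(** * Upper bound for the expectation *)

Section upper_bound.
Context {R : realType} {m : nat}.
Variables (A : set 'rV[R]_m.+1) (nu : probability 'rV[R]_m.+1 R).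
Variables (f : 'rV[R]_m.+1 -> R) (f0 f1 : R).
Hypothesis A_compact : compact A.
Hypothesis A_reg : regular_boundary A.
Hypothesis nu_density : is_density nu f.
Hypothesis nu_support : measure_support nu = A.
Hypothesis f_cont : {within A, continuous f}.
Hypothesis f0_gt0 : 0 < f0.
Hypothesis f_ge : forall x, A x -> f0 <= f x.
Hypothesis f_ge_boundary : forall y, boundary A y -> f1 <= f y.
Local Notation theta := (unit_ball_volume R m.+1).
Local Notation mass B := (fine (nu B)).

Context {disp : measure_display} {Omega : measurableType disp} (P : probability Omega R).
Variable X : nat -> {RV P >-> 'rV[R]_m.+1}.
Hypothesis X_law : forall i B, measurable B -> distribution P (X i) B = nu B.
Hypothesis X_indep : mutually_independent P X.

Lemma first_pointsP (N : Omega -> nat) w p : p \in first_points X N w <->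
  exists2 i, (i < N w)%N & p = X i w.
Proof.
split=> [/imfsetP[i /=]|[i iN ->]]; first by rewrite mem_iota => iN ->; exists i.
by apply/imfsetP; exists i => //=; rewrite mem_iota.
Qed.

(** The nets cover only the interior of [A]; this places almost every sample there. *)
Lemma outside_null : exists2 E, measurable E /\ P E = 0%E &
  forall w, ~ E w -> forall i, interior A (X i w).
Proof.
have mI := measurable_interior_compl A.
have mX i : measurable (X i @^-1` (~` interior A)).
  rewrite -[_ @^-1` _]setTI.
  exact: (@measurable_funPT _ _ _ _ (X i) measurableT _ mI).
exists (\bigcup_i (X i @^-1` (~` interior A))).
  have mU : measurable (\bigcup_i (X i @^-1` (~` interior A))).
    exact: bigcupT_measurable.
  split => //; apply/negligibleP => //; apply: negligible_bigcup => i.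
  apply/negligibleP => //.
  have := interior_compl_null A_compact A_reg nu_density nu_support.
  by move=> <-; exact: (X_law i mI).
by move=> w nE i; apply: contrapT => iA; apply: nE; exists i.
Qed.

(** Union bound: a counted component yields a centre and a choice [J] with an empty hole, whose
    probability is explicit. *)
Lemma expectation_le_holes (k : nat) (r delta : R) (s G : seq 'rV[R]_m.+1)
    (n : R) (N : {RV P >-> nat}) :
  0 < r -> 0 < delta -> 2 * delta <= 1 ->
  (forall x, cball 0 1 x -> exists2 g, g \in G & enorm (x - g) <= delta) ->
  (forall x, interior A x -> exists2 c, c \in s & cball c (delta * r) x) ->
  0 < n -> (forall j : nat, P (N @^-1` [set j]) = (poisson_pmf n j)%:E) ->
  independent_of_sequence P N X ->
  ('E_P[fun w => (nb_components k r (first_points X N w))%:R] <=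
   (\sum_(c <- s) \sum_(J : {ffun 'I_k -> 'I_(size G)})
      expR (- (n * mass (hole r delta delta J c))))%:E)%E.
Proof.
move=> r0 d0 d1 netG cov n0 N_law N_indep.
pose I := ('rV[R]_m.+1 * {ffun 'I_k -> 'I_(size G)})%type.
pose H (cJ : I) := hole r delta delta cJ.2 cJ.1.
pose E (cJ : I) := [set w | forall j, (j < N w)%N -> ~ H cJ (X j w)].
have mH cJ : measurable (H cJ) by exact: measurable_hole.
pose t : seq I := [seq (c, J) | c <- s, J <- index_enum {ffun 'I_k -> 'I_(size G)}].
have [N0 [mN0 PN0] N0P] := outside_null.
have mE cJ : measurable (E cJ) by exact: measurable_void.
apply: (le_trans (expectation_le (s := t) mE mN0 PN0 _ _)).
- by move=> w; rewrite ler0n.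
- move=> w /N0P Xw; set S := first_points X N w.
  have Scov (p : S) : exists2 c, c \in s & cball c (delta * r) (val p).
    by have /first_pointsP[i _ ->] := valP p; exact: cov.
  have := nb_components_le k (ltW r0) d1 Scov; rewrite -(ler_nat R) => /le_trans; apply.
  rewrite /t big_allpairs -sum1_count natr_sum [leLHS]big_mkcond /=.
  apply: ler_sum => c _; case: asboolP => [sp|_]; last first.
    by apply: sumr_ge0 => J _.
  have [J JP] := sparse_hole r0 (ltW d0) netG sp.
  rewrite (bigD1 J)//= (_ : \1_(E (c, J)) w = 1) ?lerDl ?sumr_ge0//.
  rewrite indicE mem_set//= => j jN.
  have Sj : X j w \in S by apply/first_pointsP; exists j.
  exact: (JP [` Sj]%fset).
rewrite (eq_bigr (fun cJ => (expR (- (n * mass (H cJ))))%:E)); last first.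
  by move=> cJ _; exact: (prob_void X_law X_indep n0 N_law N_indep (mH cJ)).
by rewrite sumEFin /t big_allpairs.
Qed.

(** A single [delta] must absorb the reduced radius, the [k] removed sub-balls and, near the
    boundary, the reduced density; all three losses vanish with [delta]. *)
Lemma small_delta (F e : R) (k : nat) : 0 < e ->
  exists delta, [/\ 0 < delta, 2 * delta <= 1,
   theta * f0 - e <= f0 * theta * (1 - delta) ^+ m.+1 - k%:R * (F * theta * delta ^+ m.+1) &
   theta * (f1 / 2) - e <= (f1 / 2 - delta) * theta * (1 - delta) ^+ m.+1 -
     k%:R * (F * theta * delta ^+ m.+1)].
Proof.
move=> e0.
have C1 (u v : R) : (u * theta * (1 - delta) ^+ m.+1 - k%:R * (F * theta * delta ^+ m.+1))
    @[delta --> 0^'+] --> u * theta * (1 - 0) ^+ m.+1 - k%:R * (F * theta * 0 ^+ m.+1).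
  apply: cvg_at_right_filter; apply: cvgB; apply: cvgM; (try exact: cvg_cst).
    apply: (@cvg_comp _ _ _ (fun s : R => 1 - s) (fun t => t ^+ m.+1) _
      (nbhs (1 - 0 : R))); last exact: exprn_continuous.
    by apply: cvgB; [exact: cvg_cst|exact: cvg_id].
  by apply: cvgM; [exact: cvg_cst|exact: exprn_continuous].
have C2 : ((f1 / 2 - delta) * theta * (1 - delta) ^+ m.+1 -
     k%:R * (F * theta * delta ^+ m.+1)) @[delta --> 0^'+] -->
    (f1 / 2 - 0) * theta * (1 - 0) ^+ m.+1 - k%:R * (F * theta * 0 ^+ m.+1).
  apply: cvg_at_right_filter; apply: cvgB; apply: cvgM; (try exact: cvg_cst).
  - apply: cvgM; last exact: cvg_cst.
    by apply: cvgB; [exact: cvg_cst|exact: cvg_id].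
  - apply: (@cvg_comp _ _ _ (fun s : R => 1 - s) (fun t => t ^+ m.+1) _
      (nbhs (1 - 0 : R))); last exact: exprn_continuous.
    by apply: cvgB; [exact: cvg_cst|exact: cvg_id].
  - by apply: cvgM; [exact: cvg_cst|exact: exprn_continuous].
have {C1} := C1 f0 0; move: C2; rewrite !subr0 !expr1n !expr0n /= !mulr0 !subr0 !mulr1.
move=> /cvgr_ge C2 /cvgr_ge C1.
have near0 : \forall delta \near (0 : R)^'+, 0 < delta /\ delta < 1 / 2.
  near=> delta; split; first by near: delta; exact: nbhs_right_gt.
  by near: delta; apply: nbhs_right_lt; rewrite divr_gt0.
have D1 : theta * f0 - e < f0 * theta by rewrite mulrC ltrBlDr ltrDl.
have D2 : theta * (f1 / 2) - e < f1 / 2 * theta by rewrite mulrC ltrBlDr ltrDl.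
have [delta [[d0 d1] [c1 c2]]] := filter_ex (filterI near0 (filterI (C1 _ D1) (C2 _ D2))).
by exists delta; split => //; lra.
Unshelve. all: by end_near. Qed.

(** A net of the interior gives no bound of order r^-m on the number of its centres near the
    boundary. So only centres with their [r]-ball inside [A] are kept, and a net of the layer
    replaces the others. *)
Lemma expectation_upper (k : nat) (e : R) : 0 < e -> exists2 C, 0 < C &
  \forall r \near 0^'+, forall (n : R) (N : {RV P >-> nat}), 0 < n ->
    (forall j : nat, P (N @^-1` [set j]) = (poisson_pmf n j)%:E) ->
    independent_of_sequence P N X ->
  ('E_P[fun w => (nb_components k r (first_points X N w))%:R] <=
   (C * (r^-1 ^+ m.+1 * expR (- (n * r ^+ m.+1 * (theta * f0 - e))) +
         r^-1 ^+ m * expR (- (n * r ^+ m.+1 * (theta * (f1 / 2) - e)))))%:E)%E.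
Proof.
move=> e0; have [F F0 fF] := density_bounded A_compact f_cont.
have [delta [d0 d1 D1 D2]] := small_delta F k e0.
have dl1 : delta <= 1 by lra.
have [G netG] := @unit_ball_net R m delta d0 dl1.
have [D D0 AD] : exists2 D, 0 < D & interior A `<=` cball 0 D.
  have [M [_ MP]] := compact_bounded A_compact.
  exists (m.+1%:R * (`|M| + 1)); first by rewrite mulr_gt0// ltr_wpDl.
  move=> x /interior_subset Ax; rewrite /cball /= subr0.
  apply: le_trans (enorm_le_norm _) _; rewrite ler_wpM2l//; apply: MP => //.
  by rewrite (le_lt_trans (ler_norm M))// ltrDl.
have [C1 C10 H1] := coverable_bounded D0 AD.
have [C2 C20 H2] := layer_net (proj1 A_reg) d0 dl1.
have bm : \forall s \near 0^'+, forall y, boundary A y ->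
    forall x, interior A x -> enorm (x - y) <= 4 * s ->
    (((f1 / 2 - delta) * theta * s ^+ m.+1)%:E <= nu (cball x s))%E.
  apply: (ball_mass_boundary f_cont nu_density A_compact A_reg f_ge_boundary).
  by rewrite ltrBlDr ltrDl.
have [e1 e10 He1] := at_rightP bm.
pose M := #|{: {ffun 'I_k -> 'I_(size G)}}|%:R : R.
have C1d : 0 < C1 * delta^-1 ^+ m.+1 by rewrite mulr_gt0// exprn_gt0// invr_gt0.
exists ((M + 1) * (C1 * delta^-1 ^+ m.+1 + C2)).
  apply: mulr_gt0; last exact: addr_gt0.
  by apply: ltr_wpDl => //; rewrite ler0n.
near=> r => n N n0 N_law N_indep.
have r0 : 0 < r by near: r; exact: nbhs_right_gt.
have r1 : r <= 1 by near: r; exact: nbhs_right_le.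
have re1 : r < e1 by near: r; exact: nbhs_right_lt.
have dr0 : 0 < delta * r by rewrite mulr_gt0.
have dr1 : delta * r <= 1 by rewrite mulr_ile1// ltW.
have [s1 [s1A s1C] s1N] := H1 _ dr0 dr1.
have [s2 [s2L s2C] s2N] := H2 _ r0 r1.
pose t1 := [seq c <- s1 | `[< cball c r `<=` A >]].
have cov x : interior A x -> exists2 c, c \in t1 ++ s2 & cball c (delta * r) x.
  move=> Ax; have [c cs xc] := s1C x Ax.
  have [cA|/existsNP[z /not_implyP[zc Az]]] := pselect (cball c r `<=` A).
    by exists c => //; rewrite mem_cat mem_filter cs andbT asboolT.
  have [c' c's xc'] : exists2 c', c' \in s2 & enorm (x - c') <= delta * r.
    apply: s2C; split => //.
    have [u [u0 u1 Bu]] := segment_boundary (interior_subset (s1A _ cs)) Az.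
    exists (c + u *: (z - c)) => //; apply: le_trans (enorm_dist_triangle c _ _) _.
    rewrite opprD addrA subrr add0r enormN enormZ ger0_norm//.
    have : u * enorm (z - c) <= r.
      by rewrite (le_trans _ zc)// ler_piMl// enorm_ge0.
    move: xc; have : delta * r <= r by rewrite ler_piMl// ltW.
    lra.
  by exists c' => //; rewrite mem_cat c's orbT.
apply: (le_trans (expectation_le_holes k r0 d0 d1 netG cov n0 N_law N_indep)).
have s0 : 0 < (1 - delta) * r by rewrite mulr_gt0//; lra.
(* [b] bounds from below the mass of the ball relative to its full Euclidean volume; [kap] is the
   exponent left after the removal of the sub-balls. *)
have key (b kap : R) c (J : {ffun 'I_k -> 'I_(size G)}) :
    b * theta * ((1 - delta) * r) ^+ m.+1 <= mass (cball c ((1 - delta) * r)) ->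
    kap <= b * theta * (1 - delta) ^+ m.+1 - k%:R * (F * theta * delta ^+ m.+1) ->
    expR (- (n * mass (hole r delta delta J c))) <= expR (- (n * r ^+ m.+1 * kap)).
  move=> bc kb; rewrite ler_expR lerN2 -mulrA ler_wpM2l ?(ltW n0)//.
  have := mass_hole A_compact nu_density nu_support delta J c r0 d0 F0 fF.
  move=> /(le_trans _); apply.
  apply: (@le_trans _ _ (r ^+ m.+1 * (b * theta * (1 - delta) ^+ m.+1 -
      k%:R * (F * theta * delta ^+ m.+1)))).
    by rewrite ler_wpM2l// exprn_ge0// ltW.
  rewrite (_ : r ^+ m.+1 * _ = b * theta * ((1 - delta) * r) ^+ m.+1 -
    k%:R * (F * theta * (delta * r) ^+ m.+1)); first by rewrite lerD2r.
  by rewrite !exprMn; ring.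
set E1 := expR (- (n * r ^+ m.+1 * (theta * f0 - e))).
set E2 := expR (- (n * r ^+ m.+1 * (theta * (f1 / 2) - e))).
have E10 : 0 <= E1 := expR_ge0 _.
have E20 : 0 <= E2 := expR_ge0 _.
rewrite lee_fin big_cat /=.
have S1 : \sum_(c <- t1) \sum_(J : {ffun 'I_k -> 'I_(size G)})
    expR (- (n * mass (hole r delta delta J c))) <= (size t1)%:R * (M * E1).
  apply: ler_sum_size => c; rewrite mem_filter => /andP[/asboolP cA _].
  rewrite (@le_trans _ _ (\sum_(J : {ffun 'I_k -> 'I_(size G)}) E1))//; last first.
    by rewrite sumr_const mulr_natl.
  apply: ler_sum => J _; apply: (key f0) => //.
  apply: (mass_ge nu_density f0_gt0 f_ge) => // x xc; apply: cA.
  by rewrite /cball /= (le_trans xc)// ler_piMl ?(ltW r0)//; lra.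
have S2 : \sum_(c <- s2) \sum_(J : {ffun 'I_k -> 'I_(size G)})
    expR (- (n * mass (hole r delta delta J c))) <= (size s2)%:R * (M * E2).
  apply: ler_sum_size => c cs2; have [Ac [y By cy]] := s2L _ cs2.
  rewrite (@le_trans _ _ (\sum_(J : {ffun 'I_k -> 'I_(size G)}) E2))//; last first.
    by rewrite sumr_const mulr_natl.
  apply: ler_sum => J _; apply: (key (f1 / 2 - delta)) => //.
  have se1 : (1 - delta) * r < e1.
    by rewrite (le_lt_trans _ re1)// ler_piMl ?(ltW r0)//; lra.
  have cy4 : enorm (c - y) <= 4 * ((1 - delta) * r).
    by rewrite (le_trans cy)// mulrA ler_wpM2r ?(ltW r0)//; lra.
  rewrite -lee_fin -massE; last exact: measurable_cball.
  exact: (He1 _ s0 se1 _ By _ Ac cy4).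
apply: (le_trans (lerD S1 S2)).
have M0 : 0 <= M by rewrite ler0n.
have t1N : (size t1)%:R <= C1 * delta^-1 ^+ m.+1 * r^-1 ^+ m.+1.
  rewrite -mulrA -exprMn -invfM; apply: le_trans s1N.
  by rewrite ler_nat size_filter count_size.
have fin (a x E : R) : 0 <= a -> 0 <= E -> a <= (C1 * delta^-1 ^+ m.+1 + C2) * x ->
    a * (M * E) <= (M + 1) * (C1 * delta^-1 ^+ m.+1 + C2) * (x * E).
  set c := _ + C2 => a0 E0 ax; rewrite (_ : a * _ = M * a * E); last by ring.
  rewrite (_ : _ * (x * E) = (M + 1) * (c * x) * E); last by ring.
  by rewrite ler_wpM2r// ler_pM// lerDl.
rewrite mulrDr; apply: lerD; apply: fin => //.
  apply: (le_trans t1N); rewrite ler_wpM2r ?exprn_ge0 ?invr_ge0 ?(ltW r0)//.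
  by rewrite lerDl ltW.
apply: (le_trans s2N); rewrite ler_wpM2r ?exprn_ge0 ?invr_ge0 ?(ltW r0)//.
by rewrite lerDr ltW.
Unshelve. all: by end_near. Qed.

End upper_bound.

(** * Lower bound for the expectation *)

Section lower_bound.
Context {R : realType} {m : nat}.
Variables (A : set 'rV[R]_m.+1) (nu : probability 'rV[R]_m.+1 R).
Variables (f : 'rV[R]_m.+1 -> R) (f0 : R).
Hypothesis A_compact : compact A.
Hypothesis A_reg : regular_boundary A.
Hypothesis nu_density : is_density nu f.
Hypothesis nu_support : measure_support nu = A.
Hypothesis f_cont : {within A, continuous f}.
Hypothesis f0_gt0 : 0 < f0.
Hypothesis f_ge : forall x, A x -> f0 <= f x.
Hypothesis f_inf : forall e, 0 < e -> exists2 x, A x & f x < f0 + e.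
Local Notation theta := (unit_ball_volume R m.+1).
Local Notation mass B := (fine (nu B)).

Context {disp : measure_display} {Omega : measurableType disp} (P : probability Omega R).
Variable X : nat -> {RV P >-> 'rV[R]_m.+1}.
Hypothesis X_law : forall i B, measurable B -> distribution P (X i) B = nu B.
Hypothesis X_indep : mutually_independent P X.

(** Disjoint cells make the [k] selected points distinct, and all other indices of the sample fall
    outside the larger ball. *)
Lemma pattern_cluster (N : {RV P >-> nat}) k (C : 'I_k -> set 'rV[R]_m.+1) a b c w :
  (forall l, C l `<=` cball c a) -> (forall l l' x, C l x -> C l' x -> l = l') ->
  pattern X N C (cball c b) w -> cluster_at k a b (first_points X N w) c.
Proof.
move=> Ca Cd [M _ [/= NM [g /=]]]; rewrite mem_fillings => /injectiveP Ig /slotsP gw.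
have Xg l : C l (X (g l) w) by have := gw (g l); rewrite slot_filled.
have Sg l : X (g l) w \in first_points X N w.
  by apply/first_pointsP; exists (g l) => //; rewrite NM.
exists (fun l => [` Sg l]%fset); split.
- move=> l l' /(congr1 val) /= E.
  by apply: Cd (Xg l) _; rewrite E; exact: Xg.
- by move=> l; exact: (Ca l _ (Xg l)).
- move=> p pb; have /first_pointsP[i] := valP p; rewrite NM => iM pE.
  have := gw (Ordinal iM); case: (boolP (Ordinal iM \in codom g)) => [/codomP[l il] _|].
    by exists l; apply: val_inj; rewrite /= pE -il.
  by move/slot_empty => -> /=; rewrite -pE => /(_ pb).
Qed.

Lemma lower_delta (e : R) : 0 < e -> exists delta, [/\ 0 < delta, 2 * delta <= 1 &
  (f0 + delta) * theta * (1 + delta) ^+ m.+1 <= theta * f0 + e].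
Proof.
move=> e0.
have C : ((f0 + delta) * theta * (1 + delta) ^+ m.+1) @[delta --> 0^'+] -->
    (f0 + 0) * theta * (1 + 0) ^+ m.+1.
  apply: cvg_at_right_filter; apply: cvgM.
    apply: cvgM; last exact: cvg_cst.
    by apply: cvgD; [exact: cvg_cst|exact: cvg_id].
  apply: (@cvg_comp _ _ _ (fun s : R => 1 + s) (fun t => t ^+ m.+1) _
    (nbhs (1 + 0 : R))); last exact: exprn_continuous.
  by apply: cvgD; [exact: cvg_cst|exact: cvg_id].
move: C; rewrite !addr0 expr1n mulr1 => /cvgr_le C.
have near0 : \forall delta \near (0 : R)^'+, 0 < delta /\ delta < 1 / 2.
  near=> delta; split; first by near: delta; exact: nbhs_right_gt.
  by near: delta; apply: nbhs_right_lt; rewrite divr_gt0.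
have D : f0 * theta < theta * f0 + e by rewrite mulrC ltrDl.
have [delta [[d0 d1] c1]] := filter_ex (filterI near0 (C _ D)).
by exists delta; split => //; lra.
Unshelve. all: by end_near. Qed.

(** A near-minimiser of [f] may lie on the boundary, but its neighbourhoods have positive mass, as
    it is in the support, while the complement of the interior is null; so interior points lie
    arbitrarily close. *)
Lemma low_density_ball (e : R) : 0 < e -> exists y0 rho, 0 < rho /\
  forall z, enorm (z - y0) <= 2 * rho -> A z /\ f z < f0 + e.
Proof.
move=> e0; have [x0 Ax0 fx0] := f_inf e0.
have [r1 r10 fr1] : exists2 r, 0 < r & forall z, A z -> cball x0 r z -> f z < f0 + e.
  apply: (within_cball f_cont (U := [set t | t < f0 + e])) => //.
  by apply: open_nbhs_nbhs; split; [exact: open_lt|].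
pose U := interior (cball x0 r1).
have oU : open U by exact: open_interior.
have Ux0 : U x0 by exact: nbhs_cball.
have [y0 [Uy0 Ay0]] : exists y, U y /\ interior A y.
  apply: contrapT => noy.
  have : measure_support nu x0 by rewrite nu_support.
  move=> /(_ U oU Ux0); apply/negP; rewrite -leNgt.
  rewrite -(interior_compl_null A_compact A_reg nu_density nu_support).
  rewrite le_measure ?inE//; [exact: measurable_open_rV|exact: measurable_interior_compl|].
  by move=> y Uy iy; apply: noy; exists y.
have : nbhs y0 (cball x0 r1 `&` A) by apply: filterI.
move=> /nbhs_cballP[r2 r20 r2P]; exists y0, (r2 / 2); split; first by rewrite divr_gt0.
move=> z zy; have [] : (cball x0 r1 `&` A) z by apply: r2P; rewrite /cball /=; lra.
by move=> zx Az; split => //; exact: fr1.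
Qed.

Lemma grid_separated (M : nat) (r : R) (y0 : 'rV[R]_m.+1) (a b : {ffun 'I_m.+1 -> 'I_M}) :
  0 < r -> a != b ->
  2 * r <= enorm ((y0 + (2 * r) *: \row_i (a i)%:R) - (y0 + (2 * r) *: \row_i (b i)%:R)).
Proof.
move=> r0 /eqP ab; have [i abi] : exists i, a i != b i.
  apply/existsP; apply: contra_notT ab; rewrite negb_exists => /forallP ab.
  by apply/ffunP => i; apply/eqP; have := ab i; rewrite negbK.
rewrite opprD addrACA subrr add0r -scalerBr enormZ gtr0_norm ?mulr_gt0//.
rewrite ler_peMr ?mulr_ge0 ?(ltW r0)//.
apply: le_trans (coord_le_enorm _ i); rewrite !mxE.
move: abi; rewrite -val_eqE neq_lt => /orP[] lt.
  rewrite distrC ger0_norm ?subr_ge0 ?ler_nat ?(ltnW lt)//.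
  by rewrite -natrB ?(ltnW lt)// ler1n subn_gt0.
rewrite ger0_norm ?subr_ge0 ?ler_nat ?(ltnW lt)//.
by rewrite -natrB ?(ltnW lt)// ler1n subn_gt0.
Qed.

Section beads.
Variables (k : nat) (r delta : R) (c : 'rV[R]_m.+1).
Hypothesis k_gt0 : (0 < k)%N.
Hypothesis r_gt0 : 0 < r.
Hypothesis delta_gt0 : 0 < delta.

(** Centres spaced by [delta r / (2 k)] along the first axis and radii [delta r / (8 k)]: the
    spacing exceeds two radii, and all beads stay within [delta r] of [c]. *)
Definition bead (l : 'I_k) : set 'rV[R]_m.+1 :=
  cball (c + (delta * r * (l%:R / (2 * k%:R))) *: delta_mx ord0 ord0)
        (delta / (8 * k%:R) * r).

Let k0 : 0 < k%:R :> R. Proof. by rewrite ltr0n. Qed.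

Lemma bead_sub l : bead l `<=` cball c (delta * r).
Proof.
apply: cball_sub; rewrite addrAC subrr add0r enormZ enorm_delta mulr1.
rewrite ger0_norm; last first.
  by rewrite mulr_ge0 ?divr_ge0 ?mulr_ge0 ?(ltW delta_gt0) ?(ltW r_gt0).
have lk : l%:R / (2 * k%:R) <= 1 / 2 :> R.
  by rewrite ler_pdivrMr ?mulr_gt0// mulrA divfK// mul1r ler_nat ltnW.
have k1 : (8 * k%:R)^-1 <= 1 / 2 :> R.
  rewrite mul1r lef_pV2 ?posrE ?mulr_gt0//; have : 1 <= k%:R :> R by rewrite ler1n.
  lra.
rewrite (_ : _ + _ = delta * r * (l%:R / (2 * k%:R) + (8 * k%:R)^-1)); last by ring.
rewrite ler_piMr ?mulr_ge0 ?(ltW delta_gt0) ?(ltW r_gt0)//; lra.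
Qed.

Lemma bead_disj l l' x : bead l x -> bead l' x -> l = l'.
Proof.
move=> xl xl'; apply: contrapT => /eqP ll'.
pose t (i : 'I_k) := c + (delta * r * (i%:R / (2 * k%:R))) *: delta_mx ord0 ord0.
have tE : enorm (t l - t l') = delta * r * (`|l%:R - l'%:R| / (2 * k%:R)).
  rewrite /t opprD addrACA subrr add0r -scalerBl enormZ enorm_delta mulr1.
  rewrite -mulrBr -mulrBl normrM [X in X * _]gtr0_norm ?mulr_gt0//.
  by rewrite normrM [X in _ * (_ * X)]gtr0_norm// invr_gt0 mulr_gt0.
have := enorm_dist_triangle x (t l) (t l'); rewrite tE.
have d1 : 1 <= `|l%:R - l'%:R| :> R.
  move: ll'; rewrite -val_eqE neq_lt => /orP[] lt.
    rewrite distrC ger0_norm ?subr_ge0 ?ler_nat ?(ltnW lt)//.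
    by rewrite -natrB ?(ltnW lt)// ler1n subn_gt0.
  rewrite ger0_norm ?subr_ge0 ?ler_nat ?(ltnW lt)//.
  by rewrite -natrB ?(ltnW lt)// ler1n subn_gt0.
move: xl xl'; rewrite /bead /cball /= enormB => xl xl'.
move=> /le_trans /(_ (lerD xl xl')); apply/negP; rewrite -ltNge.
rewrite (_ : _ + _ = delta * r * (1 / (4 * k%:R))); last by field; rewrite gt_eqF.
rewrite ltr_pM2l ?mulr_gt0//.
apply: (@lt_le_trans _ _ (1 / (2 * k%:R))).
  by rewrite !mul1r ltf_pV2 ?posrE ?mulr_gt0// ltr_pM2r//; lra.
by rewrite ler_pM2r// invr_gt0 mulr_gt0.
Qed.

End beads.

(** The centres form a grid of step [2 * r]. By [1 <= n * r ^+ m.+1], the mass of a bead times [n]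
    is at least the constant [q], so the [k] beads cost only a constant factor. *)
Lemma expectation_lower (k : nat) (e : R) : (0 < k)%N -> 0 < e -> exists2 c, 0 < c &
  \forall r \near 0^'+, forall (n : R) (N : {RV P >-> nat}), 0 < n ->
    (forall j : nat, P (N @^-1` [set j]) = (poisson_pmf n j)%:E) ->
    independent_of_sequence P N X -> 1 <= n * r ^+ m.+1 ->
  ((c * (r^-1 ^+ m.+1 * expR (- (n * r ^+ m.+1 * (theta * f0 + e)))))%:E <=
   'E_P[fun w => (nb_components k r (first_points X N w))%:R])%E.
Proof.
move=> k0 e0; have [delta [d0 d1 D]] := lower_delta e0.
have [y0 [rho [rho0 yP]]] := low_density_ball d0.
pose d : R := m.+1%:R; have dd0 : 0 < d by rewrite ltr0n.
have th0 : 0 < theta by exact: unit_ball_volume_gt0.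
have kk0 : 0 < k%:R :> R by rewrite ltr0n.
pose eta := delta / (8 * k%:R); have eta0 : 0 < eta by rewrite divr_gt0// mulr_gt0.
pose q := f0 * theta * eta ^+ m.+1.
have q0 : 0 < q by rewrite !mulr_gt0// exprn_gt0.
have rd0 : 0 < rho / (4 * d) by rewrite divr_gt0// mulr_gt0.
exists ((rho / (4 * d)) ^+ m.+1 * q ^+ k); first by rewrite mulr_gt0// exprn_gt0.
near=> r => n N n0 N_law N_indep nr1.
have r0 : 0 < r by near: r; exact: nbhs_right_gt.
have r1 : r <= rho / (2 * d).
  by near: r; apply: nbhs_right_le; rewrite divr_gt0// mulr_gt0.
have r2 : r <= rho / 2 by near: r; apply: nbhs_right_le; rewrite divr_gt0.
(* With [M] points per axis the grid stays within [2 * r * d * M <= rho] of [y0]. *)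
pose M := Num.truncn (rho / (2 * d * r)).
have x1 : 1 <= rho / (2 * d * r).
  by rewrite ler_pdivlMr ?mulr_gt0// mul1r mulrC -ler_pdivlMr ?mulr_gt0.
have /andP[Mx xM] := truncn_itv (le_trans ler01 x1).
have M1 : 1 <= M%:R :> R.
  rewrite ler1n lt0n; apply/eqP => M0; move: xM; rewrite -/M M0.
  by rewrite ltNge x1.
(* Truncation at most halves a number that is at least 1, whence 4 in place of 2. *)
have Mlow : rho / (4 * d) * r^-1 <= M%:R.
  rewrite (_ : _ / _ * _ = rho / (2 * d * r) / 2); last by field; rewrite !gt_eqF.
  move: xM; rewrite -/M -(natr1 M); set x := rho / (2 * d * r) => xM.
  by rewrite ler_pdivrMr//; lra.
pose c (a : {ffun 'I_m.+1 -> 'I_M}) := y0 + (2 * r) *: \row_i (a i)%:R.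
have cy a : enorm (c a - y0) <= rho.
  rewrite /c addrAC subrr add0r enormZ gtr0_norm ?mulr_gt0//.
  have : enorm (\row_i (a i)%:R : 'rV[R]_m.+1) <= d * M%:R.
    by apply: enorm_le_coord => i; rewrite mxE normr_nat ler_nat ltnW.
  move=> /(ler_wpM2l (ltW (mulr_gt0 (@ltr0n R 2) r0))) /le_trans; apply.
  have : d * r * 2 * M%:R <= d * r * 2 * (rho / (2 * d * r)).
    by rewrite ler_wpM2l// !mulr_ge0// ltW.
  rewrite (_ : _ * (rho / _) = rho); last by field; rewrite !gt_eqF.
  by apply: le_trans; rewrite le_eqVlt; apply/orP; left; apply/eqP; ring.
pose B a := cball (c a) ((1 + delta) * r).
have BA a z : B a z -> A z /\ f z < f0 + delta.
  move=> zB; apply: yP; apply: le_trans (enorm_dist_triangle (c a) _ _) _.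
  have : (1 + delta) * r <= 2 * r by rewrite ler_wpM2r ?(ltW r0)//; lra.
  by have := cy a; move: zB; rewrite /B /cball /=; lra.
have CB a (l : 'I_k) : bead r delta (c a) l `<=` B a.
  have sub : cball (c a) (delta * r) `<=` B a.
    by apply: cball_sub; rewrite subrr enorm0 add0r ler_wpM2r ?(ltW r0)// lerDr.
  by move=> z /(bead_sub k0 r0 d0) /sub.
have B0 : 0 < (1 + delta) * r by rewrite mulr_gt0// addr_gt0.
have PE a : ((q ^+ k * expR (- (n * r ^+ m.+1 * (theta * f0 + e))))%:E <=
    P (pattern X N (@bead k r delta (c a)) (B a)))%E.
  rewrite (prob_pattern X_law X_indep n0 N_law N_indep); last 4 first.
  - by move=> l; exact: measurable_cball.
  - exact: measurable_cball.
  - exact: CB.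
  - by move=> l l' x; exact: bead_disj.
  rewrite lee_fin; apply: ler_pM; rewrite ?exprn_ge0 ?expR_ge0 ?(ltW q0)//.
    rewrite -[k in q ^+ k]card_ord -prodr_const; apply: ler_prod => l _.
    rewrite (ltW q0) /=.
    have := mass_ge nu_density f0_gt0 f_ge (mulr_gt0 eta0 r0)
      (fun z zl => proj1 (BA a z (CB a l z zl))).
    move=> /(ler_wpM2l (ltW n0)); apply: le_trans; rewrite exprMn.
    rewrite (_ : n * _ = q * (n * r ^+ m.+1)); last by rewrite /q; ring.
    by rewrite ler_peMr// ltW.
  rewrite ler_expR lerN2 -mulrA ler_wpM2l ?(ltW n0)//.
  have fd0 : 0 <= f0 + delta by rewrite addr_ge0 ?ltW.
  apply: le_trans (mass_le A_compact nu_density nu_support B0 fd0 _) _.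
    by move=> x _ /BA[_ /ltW].
  rewrite exprMn (_ : _ * (_ * _) =
    r ^+ m.+1 * ((f0 + delta) * theta * (1 + delta) ^+ m.+1)); last by ring.
  by rewrite ler_wpM2l// exprn_ge0// ltW.
apply: (@le_trans _ _ (\sum_(a : {ffun 'I_m.+1 -> 'I_M})
    P (pattern X N (@bead k r delta (c a)) (B a))))%E; last first.
  apply: expectation_ge => [a|w].
    apply: measurable_pattern; first by move=> l; exact: measurable_cball.
    exact: measurable_cball.
  have := nb_components_ge (c := c) (first_points X N w) k0 r0 d1
    (fun a b ab => grid_separated y0 r0 ab).
  rewrite -(ler_nat R); apply: le_trans; rewrite -sum1_card natr_sum [leRHS]big_mkcond /=.
  apply: ler_sum => a _; rewrite indicE.
  case: (boolP (w \in _)) => [|_]; last by case: ifP.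
  rewrite inE => pw; rewrite ifT// inE; apply/asboolP.
  by apply: pattern_cluster pw => // [l|]; [exact: bead_sub|exact: bead_disj].
apply: (@le_trans _ _ (\sum_(a : {ffun 'I_m.+1 -> 'I_M})
    (q ^+ k * expR (- (n * r ^+ m.+1 * (theta * f0 + e))))%:E))%E; last exact: lee_sum.
rewrite sumEFin lee_fin sumr_const -[leRHS]mulr_natl card_ffun !card_ord natrX.
rewrite [leLHS](_ : _ = (rho / (4 * d) * r^-1) ^+ m.+1 *
  (q ^+ k * expR (- (n * r ^+ m.+1 * (theta * f0 + e))))); last first.
  by rewrite [X in _ = X * _]exprMn [RHS]mulrACA.
rewrite ler_wpM2r ?mulr_ge0 ?expR_ge0 ?exprn_ge0 ?(ltW q0)//.
by rewrite lerXn2r ?nnegrE ?ler0n// mulr_ge0 ?invr_ge0 ?(ltW r0) ?(ltW rd0).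
Unshelve. all: by end_near. Qed.

End lower_bound.

(** * Logarithmic asymptotics *)

Section logarithmic_asymptotics.
Context {R : realType}.

(** With [x = sqrt s], [ln s = 2 ln x <= 2 x], and [2 <= e * x] by the lower bound on [s]. *)
Lemma ln_le_linear (e s : R) : 0 < e -> 4 / e ^+ 2 <= s -> ln s <= e * s.
Proof.
move=> e0 es; have e2 : 0 < e ^+ 2 by rewrite exprn_gt0.
have s0 : 0 < s by apply: lt_le_trans es; rewrite divr_gt0.
pose x := Num.sqrt s; have x0 : 0 < x by rewrite sqrtr_gt0.
have xs : x ^+ 2 = s by rewrite sqr_sqrtr// ltW.
have xe : 2 <= e * x.
  rewrite -(@ler_pXn2r _ 2)// ?nnegrE ?mulr_ge0 ?(ltW e0) ?(ltW x0)//.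
  by rewrite exprMn xs mulrC -ler_pdivrMr//; lra.
rewrite -xs lnXn// -mulr_natl.
have := ln_sublinear x0; nra.
Qed.

Lemma limf_esup_lt (h : R -> R) (c : R) :
  (limf_esup (fun n => (h n)%:E) (pinfty_nbhs R) < c%:E)%E ->
  \forall n \near +oo, h n < c.
Proof.
rewrite /limf_esup => /ereal_inf_lt[_ [V FV <-] Vc]; apply: filterS FV => n Vn.
by rewrite -lte_fin; apply: le_lt_trans Vc; apply: ereal_sup_ubound; exists n.
Qed.

Variables (m : nat) (r I : R -> R) (theta f0 f1 : R).
Local Notation d := m.+1.
Local Notation s n := (n * r n ^+ d).
Hypothesis theta_gt0 : 0 < theta.
Hypothesis f0_gt0 : 0 < f0.
Hypothesis r_gt0 : forall n, 0 < n -> 0 < r n.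
Hypothesis s_cvg : s n @[n --> +oo] --> +oo.
Hypothesis s_log : \forall n \near +oo,
  theta * n * r n ^+ d / ln n < (Num.max f0 (d%:R * (f0 - f1 / 2)))^-1.

Let near_gt (a : R) : \forall n \near +oo, a < n.
Proof. exact: nbhs_pinfty_gt (num_real a). Qed.

Let near_s (a : R) : \forall n \near +oo, a <= s n.
Proof. by move/cvgryPge : s_cvg; exact. Qed.

(** The entry [f0] of the maximum gives [theta n r^d f0 < ln n], and [ln n] is eventually below any
    positive multiple of [n]. *)
Lemma radius_small (a : R) : 0 < a -> \forall n \near +oo, r n < a.
Proof.
move=> a0; pose c := theta * a ^+ d * f0.
have c0 : 0 < c by rewrite !mulr_gt0// exprn_gt0.
near=> n.
have n1 : 1 < n by near: n; exact: near_gt.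
have n0 : 0 < n by lra.
have nc : 4 / c ^+ 2 < n by near: n; exact: near_gt.
have ln0 : 0 < ln n by rewrite ln_gt0.
have : theta * n * r n ^+ d / ln n < f0^-1.
  apply: (@lt_le_trans _ _ (Num.max f0 (d%:R * (f0 - f1 / 2)))^-1).
    by near: n.
  rewrite lef_pV2 ?posrE ?le_max ?lexx//.
  by rewrite lt_max f0_gt0.
rewrite ltr_pdivrMr// [ltRHS]mulrC ltr_pdivlMr// => H.
rewrite -(@ltr_pXn2r _ d)// ?nnegrE ?(ltW a0) ?ltW ?r_gt0//.
have := ln_le_linear c0 (ltW nc).
rewrite -(ltr_pM2l (mulr_gt0 (mulr_gt0 theta_gt0 n0) f0_gt0)) => L.
rewrite (_ : theta * n * f0 * r n ^+ d = theta * n * r n ^+ d * f0); last by ring.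
by apply: (lt_le_trans H); apply: (le_trans L); rewrite /c le_eqVlt; apply/orP; left;
  apply/eqP; ring.
Unshelve. all: by end_near. Qed.

(** Comes from the other entry of the maximum; when that entry is not positive, neither is the left
    side, while [ln n] is. *)
Lemma boundary_exponent : \forall n \near +oo,
  theta * s n * (d%:R * (f0 - f1 / 2)) <= ln n.
Proof.
near=> n.
have n1 : 1 < n by near: n; exact: near_gt.
have n0 : 0 < n by lra.
have ln0 : 0 < ln n by rewrite ln_gt0.
have s0 : 0 < theta * s n by rewrite !mulr_gt0// exprn_gt0// r_gt0.
set D := d%:R * _; have [D0|D0] := leP D 0.
  by rewrite (le_trans _ (ltW ln0))// mulr_ge0_le0// ltW.
have : theta * n * r n ^+ d / ln n < D^-1.
  apply: (@lt_le_trans _ _ (Num.max f0 D)^-1); first by near: n.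
  by rewrite lef_pV2 ?posrE ?le_max ?lexx ?orbT// lt_max f0_gt0.
by rewrite ltr_pdivrMr// [ltRHS]mulrC ltr_pdivlMr// -mulrA => /ltW.
Unshelve. all: by end_near. Qed.

Hypothesis I_upper : forall e, 0 < e -> exists2 C, 0 < C & \forall n \near +oo,
  I n <= C * ((r n)^-1 ^+ d * expR (- (s n * (theta * f0 - e))) +
              (r n)^-1 ^+ m * expR (- (s n * (theta * (f1 / 2) - e)))).
Hypothesis I_lower : forall e, 0 < e -> exists2 c, 0 < c & \forall n \near +oo,
  c * ((r n)^-1 ^+ d * expR (- (s n * (theta * f0 + e)))) <= I n.

Lemma log_cvg : (s n)^-1 * ln (I n / n) @[n --> +oo] --> - (theta * f0).
Proof.
(* Three errors of size [e]: the one in the given bounds, the constant [C] or [c], and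
   [ln (s n)]. *)
apply/cvgrPdist_le => eps eps0; pose e := eps / 3.
have e0 : 0 < e by rewrite divr_gt0.
have [C C0 HC] := I_upper e0; have [c c0 Hc] := I_lower e0.
near=> n.
have n1 : 1 < n by near: n; exact: near_gt.
have n0 : 0 < n by lra.
have r0 := r_gt0 n0.
have s1 : 1 <= s n by near: n; exact: near_s.
have s0 : 0 < s n by lra.
have lns : ln (s n) <= e * s n.
  by apply: ln_le_linear => //; near: n; exact: near_s.
have lnC : ln (2 * C) <= e * s n.
  by rewrite [leRHS]mulrC -ler_pdivrMr//; near: n; exact: near_s.
have lnc : - ln c <= e * s n.
  by rewrite [leRHS]mulrC -ler_pdivrMr//; near: n; exact: near_s.
have bd : theta * s n * (d%:R * (f0 - f1 / 2)) <= ln n by near: n; exact: boundary_exponent.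
have d1 : 1 <= d%:R :> R by rewrite ler1n.
have lnsE : ln (s n) = ln n + d%:R * ln (r n).
  by rewrite lnM ?posrE ?exprn_gt0// lnXn// mulr_natl.
have up : I n <= C * ((r n)^-1 ^+ d * expR (- (s n * (theta * f0 - e))) +
    (r n)^-1 ^+ m * expR (- (s n * (theta * (f1 / 2) - e)))) by near: n.
have lo : c * ((r n)^-1 ^+ d * expR (- (s n * (theta * f0 + e)))) <= I n by near: n.
have rs : (r n)^-1 ^+ d / n = (s n)^-1 by rewrite invfM exprVn mulrC.
have rs' : (r n)^-1 ^+ m / n = r n / s n.
  by rewrite exprVn exprS; field; rewrite expf_neq0 ?gt_eqF.
have sV1 : (s n)^-1 <= 1 by rewrite invf_le1.
have sV0 : 0 < (s n)^-1 by rewrite invr_gt0.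
have u0 : 0 < I n / n.
  rewrite divr_gt0//; apply: lt_le_trans lo.
  by rewrite !mulr_gt0 ?expR_gt0// exprn_gt0// invr_gt0.
have lnup : ln (I n / n) <= ln (2 * C) - s n * (theta * f0 - 2 * e).
  rewrite -ler_expR lnK// expRD lnK ?posrE ?mulr_gt0//.
  set E := expR (- (s n * (theta * f0 - 2 * e))).
  have E0 : 0 < E by exact: expR_gt0.
  have b1 : (s n)^-1 * expR (- (s n * (theta * f0 - e))) <= E.
    rewrite -[leRHS]mul1r ler_pM ?expR_ge0 ?(ltW sV0)//.
    by rewrite ler_expR lerN2 ler_wpM2l ?(ltW s0)//; lra.
  have b2 : r n / s n * expR (- (s n * (theta * (f1 / 2) - e))) <= E.
    apply: (@le_trans _ _ (r n * expR (- (s n * (theta * (f1 / 2) - e))))).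
      by rewrite ler_wpM2r ?expR_ge0// ler_piMr// ltW.
    rewrite -[X in X * _](lnK (_ : r n \in Num.pos)) ?posrE// -expRD ler_expR.
    (* The factor [d] in the hypothesis is the one lost between [r ^+ d], which [s] controls, and
       the single factor [r] of the boundary term. *)
    have dlr : d%:R * ln (r n) <= d%:R * (e * s n - theta * s n * (f0 - f1 / 2)).
      rewrite mulrBr.
      have : e * s n <= d%:R * (e * s n) by rewrite ler_peMl// mulr_ge0 ?(ltW e0) ?(ltW s0).
      have : d%:R * ln (r n) = ln (s n) - ln n by rewrite lnsE addrAC subrr add0r.
      by rewrite mulrCA in bd; lra.
    by move: dlr; rewrite ler_pM2l ?ltr0n//; lra.
  rewrite ler_pdivrMr//; apply: (le_trans up).
  rewrite -ler_pdivrMr// -[leLHS]mulrA.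
  rewrite (_ : _ / n = (s n)^-1 * expR (- (s n * (theta * f0 - e))) +
     r n / s n * expR (- (s n * (theta * (f1 / 2) - e)))); last first.
    by rewrite -rs' -rs mulrDl; congr (_ + _); rewrite mulrAC.
  by rewrite [leRHS](_ : _ = C * (E + E)); [rewrite ler_wpM2l ?(ltW C0)// lerD|ring].
have lnlo : ln c - ln (s n) - s n * (theta * f0 + e) <= ln (I n / n).
  rewrite -ler_expR lnK// !expRD expRN !lnK ?posrE//.
  rewrite ler_pdivlMr//; apply: le_trans lo.
  have -> : (r n)^-1 ^+ d = n * (s n)^-1 by rewrite -rs mulrCA mulfV ?gt_eqF// mulr1.
  by move: (s n)^-1 => sV; rewrite le_eqVlt; apply/orP; left; apply/eqP; ring.
have epsE : eps = 3 * e by rewrite /e; field.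
rewrite ler_norml; apply/andP; split.
  have : (s n)^-1 * ln (I n / n) <= - (theta * f0) + 3 * e; last by lra.
  by rewrite mulrC ler_pdivrMr//; lra.
have : - (theta * f0) - 3 * e <= (s n)^-1 * ln (I n / n); last by lra.
by rewrite [leRHS]mulrC ler_pdivlMr//; lra.
Unshelve. all: by end_near. Qed.

End logarithmic_asymptotics.

Theorem theorem3p8 (R : realType) (d : nat) (d_gt0 : (0 < d)%N)
  (A : set 'rV[R]_d) (A_compact : compact A)
  (A_vol : (0 < lebesgue_rV d A)%E)
  (A_C11 : (2 <= d)%N -> C11_boundary A)
  (A_itv : d = 1%N -> is_interval [set t : R | A (const_mx t)])
  (nu : probability 'rV[R]_d R) (f : 'rV[R]_d -> R)
  (nu_density : is_density nu f) (nu_support : measure_support nu = A)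
  (f_cont : {within A, continuous f})
  (f0 f1 : R) (f0_def : f0 = inf [set f x | x in A])
  (f1_def : f1 = inf [set f x | x in boundary A]) (f0_gt0 : 0 < f0)
  (disp : measure_display) (Omega : measurableType disp)
  (P : probability Omega R)
  (X : nat -> {RV P >-> 'rV[R]_d})
  (X_law : forall i B, measurable B -> distribution P (X i) B = nu B)
  (X_indep : mutually_independent P X)
  (Z : R -> {RV P >-> nat})
  (Z_law : forall n, 0 < n ->
     forall j : nat, P (Z n @^-1` [set j]) = (poisson_pmf n j)%:E)
  (Z_indep : forall n, 0 < n -> independent_of_sequence P (Z n) X)
  (r : R -> R) (r_gt0 : forall n, 0 < n -> 0 < r n)
  (theta : R) (theta_def : theta = unit_ball_volume R d)
  (r_cvg : n * r n ^+ d @[n --> +oo] --> +oo)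
  (r_limsup :
     (limf_esup (fun n => (theta * n * r n ^+ d / ln n)%:E) (pinfty_nbhs R)
      < (Num.max f0 (d%:R * (f0 - f1 / 2)))^-1%:E)%E)
  (k : nat) (k_gt0 : (0 < k)%N)
  (I : R -> R)
  (I_def : forall n, 0 < n ->
     I n = fine 'E_P[fun w => (nb_components k (r n)
                                 (first_points X (Z n) w))%:R]) :
  (n * r n ^+ d)^-1 * ln (I n / n) @[n --> +oo] --> - (theta * f0).
Proof.
case: d d_gt0 A A_compact A_vol A_C11 A_itv nu f nu_density nu_support f_cont
  f0_def f1_def X X_law X_indep Z_indep theta_def r_cvg r_limsup I_def
  => [//|m] _ A A_compact A_vol A_C11 A_itv nu f nu_density nu_support f_cont
  f0_def f1_def X X_law X_indep Z_indep theta_def r_cvg r_limsup I_def.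
have A_reg : regular_boundary A.
  case: m A A_compact A_vol A_C11 A_itv {nu f nu_density nu_support f_cont
    f0_def f1_def X X_law X_indep Z_indep theta_def r_cvg r_limsup I_def}
    => [|m] A A_compact A_vol A_C11 A_itv; first exact: (itv_regular (A_itv erefl)).
  by apply: C11_regular => //; exact: A_C11.
have f_ge0 x : 0 <= f x by case: nu_density.
have f_lb (D : set 'rV[R]_m.+1) : has_lbound [set f x | x in D].
  by exists 0 => _ [x _ <-].
have f_ge x : A x -> f0 <= f x.
  by move=> Ax; rewrite f0_def; apply: ge_inf (f_lb A) _ _; exists x.
have f_geB y : boundary A y -> f1 <= f y.
  by move=> By; rewrite f1_def; apply: ge_inf (f_lb (boundary A)) _ _; exists y.
have A0 : A !=set0.
  by apply/set0P/eqP => A0; move: A_vol; rewrite A0 measure0 ltxx.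
have f_inf e : 0 < e -> exists2 x, A x & f x < f0 + e.
  move=> e0; have [|_ [x Ax <-] fx] := @inf_adherent R [set f x | x in A] e e0.
    by split; [case: A0 => x Ax; exists (f x), x|exact: f_lb].
  by exists x => //; rewrite f0_def.
have theta_gt0 : 0 < theta by rewrite theta_def; exact: unit_ball_volume_gt0.
have s_log := limf_esup_lt r_limsup.
have small := radius_small theta_gt0 f0_gt0 r_gt0 s_log.
have n_gt0 : \forall n \near +oo, (0 : R) < n by exact: nbhs_pinfty_gt (num_real 0).
(* Bounds for small radii become bounds for large [n], since [r n] tends to 0. *)
have pull (Q : set R) : (\forall t \near 0^'+, Q t) -> \forall n \near +oo, Q (r n).
  move=> /at_rightP[a a0 aQ]; have := small _ a0.
  by apply: filterS2 n_gt0 => n n0 ra; apply: aQ => //; exact: r_gt0.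
have upper e : 0 < e -> exists2 C, 0 < C & \forall n \near +oo,
    ('E_P[fun w => (nb_components k (r n) (first_points X (Z n) w))%:R] <=
      (C * ((r n)^-1 ^+ m.+1 * expR (- (n * r n ^+ m.+1 * (theta * f0 - e))) +
            (r n)^-1 ^+ m * expR (- (n * r n ^+ m.+1 * (theta * (f1 / 2) - e)))))%:E)%E.
  move=> e0; rewrite theta_def.
  have [C C0 /pull HC] := expectation_upper A_compact A_reg nu_density nu_support
    f_cont f0_gt0 f_ge f_geB X_law X_indep k e0.
  exists C => //; apply: filterS2 n_gt0 HC => n n0 /(_ n (Z n) n0); apply.
    exact: Z_law.
  exact: Z_indep.
have E_ge0 n : (0 <= 'E_P[fun w => (nb_components k (r n) (first_points X (Z n) w))%:R])%E.
  by rewrite expectation.unlock; apply: integral_ge0 => w _; rewrite lee_fin.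
apply: (log_cvg theta_gt0 f0_gt0 r_gt0 r_cvg s_log (f1 := f1) (m := m)) => e e0.
  have [C C0 HC] := upper e e0; exists C => //.
  apply: filterS2 n_gt0 HC => n n0; rewrite I_def//.
  by move: (E_ge0 n); case: ('E_P[_])%E.
(* The upper bound serves again: [fine] sends [+oo] to 0, so the lower bound passes to [I] only once
   the expectation is known to be finite. *)
have [C C0 HC] := upper e e0.
have [c c0 /pull Hc] := expectation_lower A_compact A_reg nu_density nu_support
  f_cont f0_gt0 f_ge f_inf X_law X_indep k_gt0 e0.
exists c => //; move/cvgryPge : r_cvg => /(_ 1) s1.
apply: filterS3 (filterI n_gt0 s1) HC Hc => n [n0 sn1] +
  /(_ n (Z n) n0 (Z_law n n0) (Z_indep n n0) sn1).
by rewrite I_def// theta_def; move: (E_ge0 n); case: ('E_P[_])%E.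
Qed.
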